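(* The Wiener index $W(G)$ of a linear $k$-tree $G$ on $n$ vertices can be computed in $O(kn^2)$ time with Algorithm 1 (written out in the context); that is, given a linear $k$-tree $G$ on $n$ vertices as input, Algorithm 1 outputs $W(G)$ and runs in $O(kn^2)$ time.
   Context: All graphs are finite, simple, undirected and loopless. The Wiener index $W(G)$ of a connected graph $G$ is the sum of the distances (lengths of shortest paths) over all unordered pairs of vertices of $G$. A $k$-tree is a graph that can be constructed recursively by starting with a copy of $K_{k+1}$ and connecting each new vertex to (exactly) the vertices of an existing $k$-clique. A linear $k$-tree is either a graph isomorphic to $K_{k+1}$, or a $k$-tree with exactly two vertices of degree $k$. A recursive labeling of a linear $k$-tree is a labeling of its vertices so that the vertices labeled $1,\dots,k+1$ form a $(k+1)$-clique, and every vertex with label $j>k+1$ is adjacent to exactly $k$ vertices with labels smaller than $j$; for $j>k+1$, $\tilde N(v_j)$ denotes the set of vertices with label smaller than $j$ adjacent to $v_j$. Algorithm 1 (input: a linear $k$-tree $G$ on $n$ vertices). (1) If $G\simeq K_n$, return $n(n-1)/2$. (2) Initialize $\tilde N(v_{n+1})=V(G)$ and $D$ as the all-zero $n\times n$ matrix. (3) For $i=n$ down to $k+2$: find a vertex in $\tilde N(v_{i+1})$ of degree $k$ in the current graph, label it $v_i$, store its (current) neighbors as $\tilde N(v_i)$, and delete $v_i$ from the current graph. (4) Label the remaining vertices $v_1,\dots,v_{k+1}$ (so $v_1,\dots,v_n$ is a recursive labeling). (5) For $\ell=1$ to $n$: for $i=\ell+1$ to $k+1$ set $D[v_i,v_\ell]=D[v_\ell,v_i]=1$;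 then for $i=\max\{\ell,k+1\}+1$ to $n$ set $D[v_i,v_\ell]=D[v_\ell,v_i]=\min_{v_j\in\tilde N(v_i)}\{D[v_\ell,v_j]\}+1$. (Loops with empty range are skipped.) (6) Return $\frac12\sum_{i=1}^n\sum_{j=1}^n D[v_i,v_j]$. Running time is counted in elementary operations (unit-cost arithmetic, comparisons and memory accesses). *)

(* Defs.v *)
From mathcomp Require Import all_boot.

Set Implicit Arguments.
Unset Strict Implicit.
Unset Printing Implicit Defensive.

(** * Graphs

A graph is a finite type [T] of vertices with a symmetric and irreflexive
adjacency relation [e : rel T]. *)

Section Graphs.

Variables (T : finType) (e : rel T).

Definition degree (x : T) : nat := #|[set y | e x y]|.

Definition clique (Q : {set T}) : bool :=
  [forall x in Q, forall y in Q, (x != y) ==> e x y].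

Definition has_path_of_length (x y : T) (d : nat) : bool :=
  [exists p : d.-tuple T, [&& path e x p, uniq (x :: p) & last x p == y]].

(* A path has fewer than [#|T|] edges, so the search range is exhaustive; the
   value is the junk [#|T|] when [x] and [y] are not connected. *)
Definition distance (x y : T) : nat :=
  find (has_path_of_length x y) (iota 0 #|T|).

(* [enum_rank] is only used to list every unordered pair once. *)
Definition wiener : nat :=
  \sum_(x : T) \sum_(y : T | enum_rank x < enum_rank y) distance x y.

(* [ktree_on k S]: the subgraph induced by [S] can be built by the recursive
   construction of k-trees. *)
Inductive ktree_on (k : nat) : {set T} -> Prop :=
| ktree_base (S : {set T}) :
    #|S| = k.+1 -> clique S -> ktree_on k S
| ktree_step (S Q : {set T}) (v : T) :
    ktree_on k S -> v \notin S ->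
    Q \subset S -> #|Q| = k -> clique Q ->
    [set u in S | e v u] = Q ->
    ktree_on k (v |: S).

Definition ktree (k : nat) : Prop := ktree_on k [set: T].

Definition linear_ktree (k : nat) : Prop :=
  (#|T| = k.+1 /\ clique [set: T])
  \/ (ktree k /\ #|[set x | degree x == k]| = 2).

End Graphs.

(** * A unit-cost imperative language

Memory consists of scalar variables and of arrays with two indices, all holding
natural numbers.  All loops are bounded, so every program terminates. *)

Inductive var :=
  | Vn | Vk        (* inputs: number of vertices, parameter k *)
  | Vres           (* output *)
  | Vcomplete      (* flag: is the input graph complete? *)
  | Vi | Vj | Vl | Vt | Vu | Vw   (* counters *)
  | Vx             (* vertex being labeled *)
  | Vcnt           (* size of the list being built *)
  | Vpos           (* position chosen in a list *)
  | Vmin | Vsum.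

Inductive arr :=
  | Adj            (* input: adjacency matrix *)
  | Deg | Alive    (* one-dimensional: degree in / membership to the current graph *)
  | N | Nsize      (* row i of N lists, from position 1 to Nsize[i], the set N~(v_i) *)
  | Cand           (* one-dimensional: candidates for the next label *)
  | Rest           (* one-dimensional: still unlabeled vertices *)
  | V              (* one-dimensional: V[i] is the vertex labeled v_i *)
  | D.             (* distances, indexed by vertices *)

Scheme Boolean Equality for var.
Scheme Boolean Equality for arr.

Inductive binop := Add | Sub | Mul | Div | Eq | Leq | And.

Inductive expr :=
  | Cst of nat
  | Read of lval
  | Bin of binop & expr & expr
with lval :=
  | Scalar of var
  | Cell of arr & expr & expr.

Inductive cmd :=
  | Skip
  | Assign of lval & expr
  | Choose of var & expr
  | Seq of cmd & cmd
  | If of expr & cmd & cmd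
  | For of var & expr & expr & cmd      (* increasing, bounds included *)
  | Down of var & expr & expr & cmd.    (* decreasing, bounds included *)

(* [choices] resolves the nondeterministic choices of a run: the m-th [Choose]
   that is executed consults [choices m]. *)
Record state := State {
  scalars : var -> nat;
  cells : arr -> nat -> nat -> nat;
  choices : nat -> nat }.

Definition set_scalar (s : state) (x : var) (a : nat) : state :=
  State (fun y => if var_beq x y then a else scalars s y) (cells s) (choices s).

Definition set_cell (s : state) (A : arr) (p q a : nat) : state :=
  State (scalars s)
    (fun B p' q' => if [&& arr_beq A B, p == p' & q == q'] then a
                    else cells s B p' q')
    (choices s).

Definition next_choice (s : state) : state :=
  State (scalars s) (cells s) (fun m => choices s m.+1).

Definition binop_eval (o : binop) (a b : nat) : nat :=
  match o with
  | Add => a + b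
  | Sub => a - b
  | Mul => a * b
  | Div => a %/ b
  | Eq => a == b
  | Leq => a <= b
  | And => (a != 0) && (b != 0)
  end.

(* Value and cost: each constant, memory access and operation costs 1. *)
Fixpoint eval (s : state) (f : expr) : nat * nat :=
  match f with
  | Cst c => (c, 1)
  | Read l =>
      match l with
      | Scalar x => (scalars s x, 1)
      | Cell A f1 f2 =>
          let: (p, t1) := eval s f1 in let: (q, t2) := eval s f2 in
          (cells s A p q, (t1 + t2).+1)
      end
  | Bin o f1 f2 =>
      let: (a, t1) := eval s f1 in let: (b, t2) := eval s f2 in
      (binop_eval o a b, (t1 + t2).+1)
  end.

Definition store (s : state) (l : lval) (a : nat) : state * nat :=
  match l with
  | Scalar x => (set_scalar s x a, 1)
  | Cell A f1 f2 =>
      let: (p, t1) := eval s f1 in let: (q, t2) := eval s f2 in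
      (set_cell s A p q a, (t1 + t2).+1)
  end.

(* Each iteration is charged 3 for incrementing, storing and testing the
   counter; the final 1 is the test that leaves the loop. *)
Fixpoint iterate (body : state -> state * nat) (x : var) (r : seq nat)
    (s : state) : state * nat :=
  if r is i :: r' then
    let: (s1, t1) := body (set_scalar s x i) in
    let: (s2, t2) := iterate body x r' s1 in
    (s2, t1 + t2 + 3)
  else (s, 1).

(* Final state and running time. *)
Fixpoint exec (c : cmd) (s : state) : state * nat :=
  match c with
  | Skip => (s, 0)
  | Assign l f =>
      let: (a, t1) := eval s f in let: (s', t2) := store s l a in
      (s', t1 + t2)
  | Choose x f =>
      (* an arbitrary number between 1 and the (positive) value of [f] *)
      let: (m, t) := eval s f in
      (set_scalar (next_choice s) x (choices s 0 %% m).+1, t.+2)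
  | Seq c1 c2 =>
      let: (s1, t1) := exec c1 s in let: (s2, t2) := exec c2 s1 in
      (s2, t1 + t2)
  | If f c1 c2 =>
      let: (a, t1) := eval s f in
      let: (s', t2) := exec (if a != 0 then c1 else c2) s in
      (s', (t1 + t2).+1)
  | For x f1 f2 c' =>
      let: (lo, t1) := eval s f1 in let: (hi, t2) := eval s f2 in
      let: (s', t) := iterate (exec c') x (iota lo (hi.+1 - lo)) s in
      (s', t1 + t2 + t)
  | Down x f1 f2 c' =>
      let: (hi, t1) := eval s f1 in let: (lo, t2) := eval s f2 in
      let: (s', t) := iterate (exec c') x (rev (iota lo (hi.+1 - lo))) s in
      (s', t1 + t2 + t)
  end.

Definition output (c : cmd) (s : state) : nat := scalars (exec c s).1 Vres.

Definition running_time (c : cmd) (s : state) : nat := (exec c s).2.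

Coercion Cst : nat >-> expr.
Coercion Read : lval >-> expr.
Coercion Scalar : var >-> lval.

Declare Scope prog_scope.
Delimit Scope prog_scope with prog.
Bind Scope prog_scope with expr.
Bind Scope prog_scope with lval.
Bind Scope prog_scope with cmd.

Notation "f1 + f2" := (Bin Add f1 f2) : prog_scope.
Notation "f1 - f2" := (Bin Sub f1 f2) : prog_scope.
Notation "f1 * f2" := (Bin Mul f1 f2) : prog_scope.
Notation "f1 / f2" := (Bin Div f1 f2) : prog_scope.
Notation "f1 == f2" := (Bin Eq f1 f2) : prog_scope.
Notation "f1 <= f2" := (Bin Leq f1 f2) : prog_scope.
Notation "f1 && f2" := (Bin And f1 f2) : prog_scope.
Notation "A @[ f1 , f2 ]" := (Cell A f1 f2)
  (at level 2, f1, f2 at level 200, left associativity) : prog_scope.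
Notation "A @[ f ]" := (Cell A 0 f)
  (at level 2, f at level 200, left associativity) : prog_scope.
Notation "l <~ f" := (Assign l f) (at level 80, no associativity) : prog_scope.
Notation "'CHOOSE' x 'UPTO' f" := (Choose x f)
  (at level 80, x at level 1, f at level 79) : prog_scope.
Notation "c1 ;; c2" := (Seq c1 c2) (at level 90, right associativity) : prog_scope.
Notation "'IF' f 'THEN' c1 'ELSE' c2 'FI'" := (If f c1 c2)
  (at level 0, f at level 200, c1 at level 200, c2 at level 200) : prog_scope.
Notation "'FOR' x 'FROM' f1 'TO' f2 'LOOP' c 'POOL'" := (For x f1 f2 c)
  (at level 0, x at level 1, f1 at level 200, f2 at level 200,
   c at level 200) : prog_scope.
Notation "'FOR' x 'FROM' f1 'DOWNTO' f2 'LOOP' c 'POOL'" := (Down x f1 f2 c)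
  (at level 0, x at level 1, f1 at level 200, f2 at level 200,
   c at level 200) : prog_scope.

(** * The algorithm *)

Definition test_complete : cmd := (
  Vcomplete <~ 1;;
  FOR Vi FROM 1 TO Vn LOOP
    FOR Vj FROM Vi + 1 TO Vn LOOP
      IF Adj@[Vi, Vj] == 0 THEN Vcomplete <~ 0 ELSE Skip FI
    POOL
  POOL)%prog.

(* Besides N~(v_(n+1)) and D, set up the bookkeeping of the current graph. *)
Definition initialize : cmd := (
  Nsize@[Vn + 1] <~ Vn;;
  FOR Vu FROM 1 TO Vn LOOP
    N@[Vn + 1, Vu] <~ Vu;;
    Alive@[Vu] <~ 1;;
    Deg@[Vu] <~ 0;;
    FOR Vw FROM 1 TO Vn LOOP
      D@[Vu, Vw] <~ 0;;
      Deg@[Vu] <~ Deg@[Vu] + Adj@[Vu, Vw]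
    POOL
  POOL)%prog.

Definition eliminate : cmd := (
  FOR Vi FROM Vn DOWNTO Vk + 2 LOOP
    Vcnt <~ 0;;
    FOR Vt FROM 1 TO Nsize@[Vi + 1] LOOP
      Vu <~ N@[Vi + 1, Vt];;
      IF Deg@[Vu] == Vk THEN
        Vcnt <~ Vcnt + 1;;
        Cand@[Vcnt] <~ Vu
      ELSE Skip FI
    POOL;;
    CHOOSE Vpos UPTO Vcnt;;
    Vx <~ Cand@[Vpos];;
    V@[Vi] <~ Vx;;
    Vcnt <~ 0;;
    FOR Vu FROM 1 TO Vn LOOP
      IF Alive@[Vu] && Adj@[Vx, Vu] THEN
        Vcnt <~ Vcnt + 1;;
        N@[Vi, Vcnt] <~ Vu;;
        Deg@[Vu] <~ Deg@[Vu] - 1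
      ELSE Skip FI
    POOL;;
    Nsize@[Vi] <~ Vcnt;;
    Alive@[Vx] <~ 0
  POOL)%prog.

(* Any order of the remaining vertices may be chosen. *)
Definition label_rest : cmd := (
  Vcnt <~ 0;;
  FOR Vu FROM 1 TO Vn LOOP
    IF Alive@[Vu] THEN
      Vcnt <~ Vcnt + 1;;
      Rest@[Vcnt] <~ Vu
    ELSE Skip FI
  POOL;;
  FOR Vi FROM Vk + 1 DOWNTO 1 LOOP
    CHOOSE Vpos UPTO Vi;;
    V@[Vi] <~ Rest@[Vpos];;
    Rest@[Vpos] <~ Rest@[Vi]
  POOL)%prog.

Definition fill_distances : cmd := (
  FOR Vl FROM 1 TO Vn LOOP
    FOR Vi FROM Vl + 1 TO Vk + 1 LOOP
      D@[V@[Vi], V@[Vl]] <~ 1;;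
      D@[V@[Vl], V@[Vi]] <~ 1
    POOL;;
    IF Vl <= Vk + 1 THEN Vw <~ Vk + 1 ELSE Vw <~ Vl FI;;
    FOR Vi FROM Vw + 1 TO Vn LOOP
      Vmin <~ D@[V@[Vl], N@[Vi, 1]];;
      FOR Vt FROM 2 TO Nsize@[Vi] LOOP
        Vu <~ D@[V@[Vl], N@[Vi, Vt]];;
        IF Vu <= Vmin THEN Vmin <~ Vu ELSE Skip FI
      POOL;;
      D@[V@[Vi], V@[Vl]] <~ Vmin + 1;;
      D@[V@[Vl], V@[Vi]] <~ Vmin + 1
    POOL
  POOL)%prog.

Definition half_sum : cmd := (
  Vsum <~ 0;;
  FOR Vi FROM 1 TO Vn LOOP
    FOR Vj FROM 1 TO Vn LOOP
      Vsum <~ Vsum + D@[V@[Vi], V@[Vj]]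
    POOL
  POOL;;
  Vres <~ Vsum / 2)%prog.

Definition algorithm1 : cmd := (
  test_complete;;
  IF Vcomplete THEN
    Vres <~ Vn * (Vn - 1) / 2
  ELSE
    initialize;;
    eliminate;;
    label_rest;;
    fill_distances;;
    half_sum
  FI)%prog.

(* The memory [s] holds the graph [e] on ['I_n] together with [k]; the vertex
   [i : 'I_n] is represented by the number [i.+1].  The rest of the memory and
   the stream of choices are arbitrary. *)
Definition holds_input (k n : nat) (e : rel 'I_n) (s : state) : Prop :=
  [/\ scalars s Vn = n, scalars s Vk = k &
      forall i j : 'I_n, cells s Adj i.+1 j.+1 = e i j].

(* Main.v *)
Require Import Defs.
From mathcomp Require Import all_boot zify.

Set Implicit Arguments.
Unset Strict Implicit.
Unset Printing Implicit Defensive.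

(** The graph-theoretic core is that the elimination never gets stuck and yields a
perfect elimination order. In a k-tree with more than [k + 1] vertices there are
at least two vertices of degree [k] (leaves), no two leaves are adjacent, the
neighbors of a leaf form a clique, and deleting a leaf leaves a k-tree. When there
are exactly two leaves and one of them, [v], is deleted, at most one old leaf
survives, and at most one neighbor of [v] becomes a leaf because these neighbors
are pairwise adjacent. At least two leaves must be present again, so both happen:
as long as more than [k + 1] vertices remain, there are exactly two leaves, and
one of them is a neighbor of [v] ([linear_remove_leaf]). Hence a next vertex can
always be found among the neighbors of the previous one, whichever candidate was
chosen.

The labels then have the property that the earlier neighbors of each vertex form a
clique. Any path to [y] that goes through later vertices can be shortcut inside
such cliques, so from a vertex [x] labeled before [y] a shortest path reaches [y]
through an earlier neighbor ([distance_via_earlier]), and the distance is one more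
than the minimum of the distances to the earlier neighbors of [y]
([distance_min]). The loops visit the pairs in an order for which these distances
are already in memory; this is the invariant [known].

The program is verified with a judgement [runs c s t Q]: started in [s], the
command [c] ends in a state satisfying [Q] after at most [t] steps. Each loop has
an invariant indexed by the number of iterations done, and a syntactic frame
property takes care of everything that a command does not touch. The partial
labeling is described by a function on the vertices with value 0 on the vertices
that are still unlabeled; with this convention the earlier neighbors of a labeled
vertex do not depend on how the remaining vertices get labeled.

As for the time, the lists of earlier neighbors have exactly [k] entries, so each
of the at most [n ^ 2] minima costs [O(k)]; every other part of the program
consists of at most two nested loops, with [O(n ^ 2)] iterations. The numerical
constants in the time bounds are generous and have no significance. *)

(** * Distances *)

Section Distance.

Variables (T : finType) (e : rel T).

(** Arbitrary walks suffice as upper bounds, since removing loops only shortens them. *)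
Lemma distance_le_path x p : path e x p -> distance e x (last x p) <= size p.
Proof.
case/shortenP=> q pq uq sub_qp; have [_ /= uniq_q] := andP uq.
apply: leq_trans (uniq_leq_size uniq_q sub_qp); rewrite leqNgt; apply/negP=> lt_q.
have q_small : size q < #|T| by rewrite -[_.+1]/(size (x :: q)) -(card_uniqP uq) max_card.
have /negP[] := negbT (before_find 0 lt_q).
rewrite nth_iota // add0n; apply/existsP; exists (in_tuple q).
by rewrite pq eqxx uq.
Qed.

(** For connected vertices the search defining the distance succeeds: a loop-free
path has fewer than [#|T|] edges. *)
Lemma connect_shortest x y :
  connect e x y -> exists p, [/\ path e x p, last x p = y & size p = distance e x y].
Proof.
case/connectP=> p ep ->; case/shortenP: ep => q pq uq _.
have d_small : distance e x (last x q) < #|T|.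
  apply: leq_ltn_trans (distance_le_path pq) _.
  by rewrite -[_.+1]/(size (x :: q)) -(card_uniqP uq) max_card.
have : has (has_path_of_length e x (last x q)) (iota 0 #|T|) by rewrite has_find size_iota.
move/(nth_find 0); rewrite nth_iota // add0n => /existsP[r /and3P[pr _ /eqP lr]].
by exists r; split=> //; rewrite size_tuple.
Qed.

Lemma distance_refl x : distance e x x = 0.
Proof. by apply/eqP; rewrite -leqn0; exact: (@distance_le_path x [::]). Qed.

Hypothesis connected_e : forall x y, connect e x y.

Lemma distance_eq0 x y : distance e x y = 0 -> x = y.
Proof.
move=> d0; have [p [_ ]] := connect_shortest (connected_e x y).
by rewrite d0; case: p.
Qed.

Lemma distance_edge x y z : e z y -> distance e x y <= (distance e x z).+1.
Proof.
have [p [pp lp <-]] := connect_shortest (connected_e x z) => ezy.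
rewrite -(size_rcons p y) -[y in distance _ _ y](last_rcons x p y).
by apply: distance_le_path; rewrite rcons_path pp lp.
Qed.

(** The last edge of a shortest path; this is what inductions on the distance use. *)
Lemma distance_last_edge x y :
  x != y -> exists2 z, e z y & distance e x y = (distance e x z).+1.
Proof.
have [p [pp lp sp]] := connect_shortest (connected_e x y).
case/lastP: p pp lp sp => [_ /= -> |p y' pp lp sp _]; first by rewrite eqxx.
move: lp pp sp; rewrite last_rcons rcons_path size_rcons => -> /andP[pp epy] sp.
exists (last x p) => //; apply/eqP; rewrite eqn_leq distance_edge //= -sp ltnS.
exact: distance_le_path.
Qed.

Hypothesis sym_e : symmetric e.

Lemma distance_sym x y : distance e x y = distance e y x.
Proof.
wlog suff le_d : x y / distance e x y <= distance e y x.
  by apply/eqP; rewrite eqn_leq !le_d.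
have [p [pp lp <-]] := connect_shortest (connected_e y x).
rewrite -(size_belast y p) -size_rev.
have {1}-> : y = last x (rev (belast y p)).
  by case: p pp lp => [_ /= ->|a p _ _] //=; rewrite rev_cons last_rcons.
apply: distance_le_path; rewrite -lp rev_path.
by rewrite (eq_path (e' := e)) // => a b; rewrite sym_e.
Qed.

(** The ordered pairs split into the diagonal and two mirror images of the sum that
defines the Wiener index. *)
Lemma sum_distance : \sum_x \sum_y distance e x y = (wiener e).*2.
Proof.
rewrite /wiener -addnn.
transitivity (\sum_x (\sum_(y | enum_rank x < enum_rank y) distance e x y
                    + \sum_(y | enum_rank y < enum_rank x) distance e x y)).
  apply: eq_bigr => x _.
  rewrite (bigID (fun y => enum_rank x < enum_rank y)) /=; congr (_ + _).
  rewrite (bigID (fun y => y == x)) /= [X in X + _]big1 ?add0n; last first.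
    by move=> y /andP[_ /eqP->]; rewrite distance_refl.
  apply: eq_bigl => y; rewrite -leqNgt andbC ltn_neqAle.
  by congr (~~ _ && _); rewrite (inj_eq val_inj) (inj_eq enum_rank_inj).
rewrite big_split /=; congr (_ + _).
rewrite (exchange_big_dep xpredT) //=.
by apply: eq_bigr => x _; apply: eq_bigr => y _; rewrite distance_sym.
Qed.

Lemma distance_adjacent x y : x != y -> e x y -> distance e x y = 1.
Proof.
move=> neq exy; apply/eqP; rewrite eqn_leq.
rewrite (leq_trans (distance_edge _ exy)) ?distance_refl //= lt0n.
by apply: contra neq => /eqP/distance_eq0->.
Qed.

End Distance.

(** * Distances along a perfect elimination order *)

Lemma cliqueP (T : finType) (e : rel T) (A : {set T}) :
  reflect {in A &, forall x y, x != y -> e x y} (clique e A).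
Proof.
apply: (iffP forall_inP) => cA x; last first.
  by move=> Ax; apply/forall_inP => y Ay; apply/implyP; apply: cA.
by move=> y /cA/forall_inP H Ay; apply/implyP/H.
Qed.

Definition earlier (T : finType) (e : rel T) (lab : T -> nat) (x : T) : {set T} :=
  [set y | e x y & lab y < lab x].

Section Elimination.

Variables (T : finType) (e : rel T) (lab : T -> nat).
Hypotheses (sym_e : symmetric e) (irr_e : irreflexive e).
Hypothesis connected_e : forall x y, connect e x y.
Hypothesis lab_inj : injective lab.
Hypothesis clique_earlier : forall x, clique e (earlier e lab x).

(** By induction on the distance: let [z] precede [y] on a shortest path from [x].
If [z] is later than [y], then by induction a shortest path to [z] arrives through
an earlier neighbor [w] of [z]; since [w] and [y] lie in a common clique, going
from [w] directly to [y] would be shorter than the path through [z]. *)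
Lemma distance_via_earlier x y : lab x < lab y ->
  exists2 w, w \in earlier e lab y & distance e x y = (distance e x w).+1.
Proof.
move dE : (distance e x y) => d; elim: d y dE => [|d IHd] y dE ltxy.
  by move: ltxy; rewrite (distance_eq0 connected_e dE) ltnn.
have [|z ezy] := distance_last_edge connected_e (x := x) (y := y).
  by apply: contraTneq ltxy => ->; rewrite ltnn.
rewrite dE => -[dz]; case: (ltngtP (lab z) (lab y)) => [ltzy | ltyz | /lab_inj zy].
- by exists z; rewrite ?inE ?ltzy -?dz // sym_e ezy.
- have [w wz dw] := IHd z (esym dz) (ltn_trans ltxy ltyz).
  have yz : y \in earlier e lab z by rewrite inE ezy.
  have [wy|neq_wy] := eqVneq w y.
    by exfalso; move: dE; rewrite -wy dw; lia.
  have ewy := elimT (cliqueP _ _) (clique_earlier z) w y wz yz neq_wy.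
  by have := distance_edge connected_e x ewy; rewrite dE dw; lia.
- by move: ezy; rewrite zy irr_e.
Qed.

Lemma distance_min x y m : lab x < lab y ->
  (exists2 w, w \in earlier e lab y & distance e x w = m) ->
  {in earlier e lab y, forall w, m <= distance e x w} ->
  distance e x y = m.+1.
Proof.
move=> ltxy [w wy <-] le_m; apply/eqP; rewrite eqn_leq distance_edge //=; last first.
  by move: wy; rewrite inE sym_e => /andP[].
by have [w' /le_m le' ->] := distance_via_earlier ltxy.
Qed.

End Elimination.

(** * k-trees *)

(** The current graph of the elimination is the subgraph induced by a set [S]. *)
Definition nbrs (T : finType) (e : rel T) (S : {set T}) (x : T) : {set T} :=
  [set y in S | e x y].

Definition leaves (T : finType) (e : rel T) (k : nat) (S : {set T}) : {set T} :=
  [set x in S | #|nbrs e S x| == k].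

Section KTrees.

Variables (T : finType) (e : rel T) (k : nat).
Hypotheses (sym_e : symmetric e) (irr_e : irreflexive e).

Implicit Types S Q : {set T}.

Lemma clique_sub S Q : Q \subset S -> clique e S -> clique e Q.
Proof.
move=> /subsetP sQS /cliqueP cS; apply/cliqueP=> x y /sQS Sx /sQS Sy; exact: cS.
Qed.

Lemma nbrs_setU1 S v u : v \notin S ->
  #|nbrs e (v |: S) u| = e u v + #|nbrs e S u|.
Proof.
move=> nSv; have -> : nbrs e (v |: S) u = if e u v then v |: nbrs e S u else nbrs e S u.
  by apply/setP=> y; case: ifP => euv; rewrite !inE; case: (eqVneq y v) => // ->;
     rewrite euv // (negPf nSv).
by case: ifP => euv //; rewrite cardsU1 inE (negPf nSv).
Qed.

Lemma nbrs_setD1 S v u : v \in S ->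
  #|nbrs e S u| = e u v + #|nbrs e (S :\ v) u|.
Proof. by move=> Sv; rewrite -nbrs_setU1 ?setD1K // !inE eqxx. Qed.

Lemma clique_degree S u : clique e S -> u \in S -> #|nbrs e S u| = #|S|.-1.
Proof.
move=> /cliqueP cS Su; rewrite (cardsD1 u S) Su /=; congr #|pred_of_set _|.
apply/setP=> y; rewrite !inE andbC; case: (eqVneq y u) => [->|neq] /=; first by rewrite irr_e.
by case Sy: (y \in S); rewrite ?andbF ?andbT //; apply: cS => //; rewrite eq_sym.
Qed.

Lemma ktree_card S : ktree_on e k S -> k < #|S|.
Proof.
elim=> [{}S -> //|{}S Q v _ ltS nSv *].
by rewrite cardsU1 nSv ltnS (leq_trans (leqnSn _)).
Qed.

Lemma ktree_small S : ktree_on e k S -> #|S| = k.+1 -> clique e S.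
Proof.
case=> // {}S Q v /ktree_card ltS nSv _ _ _ _.
by rewrite cardsU1 nSv => -[]; lia.
Qed.

Lemma ktree_degree S u : ktree_on e k S -> u \in S -> k <= #|nbrs e S u|.
Proof.
move=> tS; elim: tS u => [{}S cS clS u Su|{}S Q v _ IH nSv _ cQ _ nQ u].
  by rewrite clique_degree // cS.
rewrite !inE nbrs_setU1 //; case: eqP => [-> _|_ /= /IH]; last by lia.
by rewrite /nbrs nQ cQ leq_addl.
Qed.

Lemma ktree_connected S : 0 < k -> ktree_on e k S -> {in S &, forall x y, connect e x y}.
Proof.
move=> k_gt0; elim=> [{}S _ /cliqueP cS x y Sx Sy|{}S Q v _ IH nSv sQS cQ _ nQ].
  by have [->|neq] := eqVneq x y; [exact: connect0 | exact/connect1/cS].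
have [q Qq] : exists q, q \in Q by apply/card_gt0P; rewrite cQ.
have [Sq evq] : q \in S /\ e v q by apply/andP; move: Qq; rewrite -nQ inE.
have cv y : y \in S -> connect e v y.
  by move=> Sy; apply: connect_trans (connect1 evq) (IH _ _ Sq Sy).
have csym := sym_connect_sym sym_e.
move=> x y /setU1P[->|Sx] /setU1P[->|Sy]; rewrite ?connect0 ?cv //; last exact: IH.
by rewrite csym cv.
Qed.

(** By induction on the construction.  If [u] is not the last vertex [v] added, it is
not adjacent to [v], as its degree in the smaller k-tree is at least [k] already;
so [v] can equally well be added after the removal of [u]. *)
Lemma ktree_remove_leaf S u : ktree_on e k S -> k.+1 < #|S| -> u \in leaves e k S ->
  ktree_on e k (S :\ u) /\ clique e (nbrs e S u).
Proof.
move=> tS; elim: tS u => [{}S -> _|{}S Q v tS IH nSv sQS cQ clQ nQ] u; first by rewrite ltnn.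
have nv : nbrs e (v |: S) v = Q.
  by rewrite -nQ; apply/setP=> y; rewrite !inE; case: eqP => // ->; rewrite irr_e (negPf nSv).
rewrite cardsU1 nSv ltnS => ltS; rewrite inE => /andP[/setU1P[->|Su]].
  by rewrite nv cQ => _; rewrite setU1K.
have neq_uv : u != v by apply: contraNneq nSv => <-.
rewrite nbrs_setU1 // => /eqP du.
have := ktree_degree tS Su; rewrite leqNgt => /negP deg_u.
(* Otherwise [u] would have degree less than [k] before [v] was added *)
have Nuv : e u v = false by case: (e u v) du deg_u => //; lia.
have {}du : #|nbrs e S u| = k by rewrite Nuv in du.
have nu : nbrs e (v |: S) u = nbrs e S u.
  by apply/setP=> y; rewrite !inE; case: eqP => // ->; rewrite Nuv !andbF.
have nQu : u \notin Q by rewrite -nQ inE sym_e Nuv andbF.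
have sQ : Q \subset S :\ u.
  by apply/subsetP=> q Qq; rewrite !inE (subsetP sQS) // andbT; apply: contraNneq nQu => <-.
have [tSu clu] : ktree_on e k (v |: (S :\ u)) /\ clique e (nbrs e S u); last first.
  split; last by rewrite nu.
  by have -> : (v |: S) :\ u = v |: (S :\ u) by
    apply/setP=> y; rewrite !inE; case: (eqVneq y v) => //= ->; rewrite eq_sym neq_uv.
have nSuv : v \notin S :\ u by rewrite !inE (negPf nSv) andbF.
(* When only k + 1 vertices are left without [v], removing [u] makes [v] part of a
   new (k+1)-clique, and there is no smaller tree to apply the induction to. *)
have [eqS|neqS] := eqVneq #|S| k.+1; last first.
  have [||tSu clu] := IH u; rewrite ?inE ?Su ?du ?eqxx //.
    by rewrite ltn_neqAle eq_sym neqS.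
  split=> //; apply: (ktree_step (Q := Q)) => //.
  by rewrite -nQ; apply/setP=> y; rewrite !inE; case: eqP => // ->; rewrite sym_e Nuv !andbF.
have clS := ktree_small tS eqS; have cSu : #|S :\ u| = k.
  by move: eqS; rewrite (cardsD1 u) Su => -[].
have eqQ : Q = S :\ u by apply/eqP; rewrite eqEcard sQ cQ cSu leqnn.
split; last by apply: clique_sub clS; apply/subsetP=> y; rewrite inE => /andP[].
apply: ktree_base; first by rewrite cardsU1 nSuv cSu.
rewrite -eqQ; apply/cliqueP => x y /setU1P[->|Qx] /setU1P[->|Qy]; rewrite ?eqxx //.
- by move=> _; move: Qy; rewrite -nQ inE => /andP[].
- by move=> _; move: Qx; rewrite -nQ inE sym_e => /andP[].
exact: (elimT (cliqueP _ _) clQ).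
Qed.

(** Removing one of two adjacent leaves would leave the other with degree [k - 1]. *)
Lemma leaves_not_adjacent S u v : ktree_on e k S -> k.+1 < #|S| ->
  u \in leaves e k S -> v \in leaves e k S -> ~~ e u v.
Proof.
move=> tS ltS Lu Lv; apply/negP=> euv.
have [tSu _] := ktree_remove_leaf tS ltS Lu.
move: Lu Lv; rewrite !inE => /andP[Su _] /andP[Sv].
rewrite (nbrs_setD1 _ Su) sym_e euv => /eqP dv.
have : v \in S :\ u by rewrite !inE Sv andbT; apply: contraTneq euv => ->; rewrite irr_e.
by move/(ktree_degree tSu); lia.
Qed.

(** The last vertex added is a leaf.  The clique it is attached to cannot contain both
of two non-adjacent leaves, so one of them remains a leaf; if the smaller graph is a
(k+1)-clique, the vertex outside the attaching clique does. *)
Lemma ktree_two_leaves S : ktree_on e k S -> k.+1 < #|S| -> 1 < #|leaves e k S|.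
Proof.
elim=> [{}S -> _|{}S Q v tS IH nSv sQS cQ clQ nQ]; first by rewrite ltnn.
rewrite cardsU1 nSv ltnS => ltS.
suff [u Su [nQu /eqP du]] : exists2 u, u \in S & u \notin Q /\ #|nbrs e S u| = k.
  have neq_uv : u != v by apply: contraNneq nSv => <-.
  have Nuv : e u v = false.
    by apply: contraNF nQu => euv; rewrite -nQ inE Su sym_e.
  apply/card_gt1P; exists u, v; split=> //;
    rewrite !inE ?Su ?eqxx ?orbT ?nbrs_setU1 ?irr_e ?Nuv //.
  by rewrite /nbrs nQ cQ eqxx.
have [eqS|neqS] := eqVneq #|S| k.+1.
  have [u] : exists u, u \in S :\: Q.
    by apply/card_gt0P; rewrite cardsD (setIidPr sQS) cQ eqS subSnn.
  rewrite inE => /andP[nQu Su]; exists u => //; split=> //.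
  by rewrite clique_degree ?eqS ?(ktree_small tS).
have {}ltS : k.+1 < #|S| by rewrite ltn_neqAle eq_sym neqS.
have /card_gt1P[u [w [Lu Lw neq_uw]]] := IH ltS.
have nadj := leaves_not_adjacent tS ltS Lu Lw.
move: Lu Lw; rewrite !inE => /andP[Su /eqP du] /andP[Sw /eqP dw].
have [Qu|nQu] := boolP (u \in Q); last by exists u.
exists w => //; split=> //; apply: contra nadj => Qw.
exact: (elimT (cliqueP _ _) clQ).
Qed.

(** The step that keeps the elimination going: [old] and [new1] bound the leaves of the
smaller graph outside and inside the neighborhood of [v] by one each, and there are
at least two of them. *)
Lemma linear_remove_leaf S v :
  ktree_on e k S -> k.+2 < #|S| -> #|leaves e k S| = 2 -> v \in leaves e k S ->
  #|leaves e k (S :\ v)| = 2 /\ exists2 u, u \in nbrs e S v & u \in leaves e k (S :\ v).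
Proof.
move=> tS lt2 two Lv; have ltS := ltnW lt2.
have Sv : v \in S by move: Lv; rewrite inE => /andP[].
have [tSv clv] := ktree_remove_leaf tS ltS Lv.
have ltSv : k.+1 < #|S :\ v| by move: lt2; rewrite (cardsD1 v S) Sv.
have gt1 := ktree_two_leaves tSv ltSv.
have old : leaves e k (S :\ v) :\: nbrs e S v \subset leaves e k S :\ v.
  apply/subsetP=> u; rewrite !inE => /andP[nvu /andP[/andP[neq Su] /eqP du]].
  rewrite neq Su (nbrs_setD1 _ Sv) du /=.
  by move: nvu; rewrite Su sym_e /= => /negPf ->.
have old1 : #|leaves e k (S :\ v) :\: nbrs e S v| <= 1.
  apply: leq_trans (subset_leq_card old) _.
  by rewrite -ltnS -two (cardsD1 v (leaves e k S)) Lv.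
have new1 : #|leaves e k (S :\ v) :&: nbrs e S v| <= 1.
  rewrite leqNgt; apply/negP=> /card_gt1P[x [y [/setIP[Lx nx] /setIP[Ly ny] neq]]].
  by have /negP[] := leaves_not_adjacent tSv ltSv Lx Ly; apply: (elimT (cliqueP _ _) clv).
have := cardsID (nbrs e S v) (leaves e k (S :\ v)) => split_card.
split; first by lia.
have /card_gt0P[u /setIP[]] : 0 < #|leaves e k (S :\ v) :&: nbrs e S v| by lia.
by exists u.
Qed.

End KTrees.

(** * Reasoning about programs *)

Fixpoint assigns (c : cmd) (y : var) : bool :=
  match c with
  | Skip => false
  | Assign (Scalar x) _ => var_beq x y
  | Assign (Cell _ _ _) _ => false
  | Choose x _ => var_beq x y
  | Seq c1 c2 => assigns c1 y || assigns c2 y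
  | If _ c1 c2 => assigns c1 y || assigns c2 y
  | For x _ _ c' => var_beq x y || assigns c' y
  | Down x _ _ c' => var_beq x y || assigns c' y
  end.

Fixpoint writes (c : cmd) (A : arr) : bool :=
  match c with
  | Skip => false
  | Assign (Scalar _) _ => false
  | Assign (Cell B _ _) _ => arr_beq B A
  | Choose _ _ => false
  | Seq c1 c2 => writes c1 A || writes c2 A
  | If _ c1 c2 => writes c1 A || writes c2 A
  | For _ _ _ c' => writes c' A
  | Down _ _ _ c' => writes c' A
  end.

(** What can be said of a run of [c] from its text alone. *)
Definition frame (c : cmd) (s s' : state) : Prop :=
  (forall y, ~~ assigns c y -> scalars s' y = scalars s y) /\
  (forall A, ~~ writes c A -> cells s' A = cells s A).

Lemma frame_refl c s : frame c s s.
Proof. by []. Qed.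

Lemma iterate_frame c x r s :
  (forall s0, frame c s0 (exec c s0).1) ->
  (forall y, ~~ (var_beq x y || assigns c y) ->
     scalars (iterate (exec c) x r s).1 y = scalars s y) /\
  (forall A, ~~ writes c A -> cells (iterate (exec c) x r s).1 A = cells s A).
Proof.
move=> fc; elim: r s => //= i r IH s.
have := fc (set_scalar s x i); case: (exec c _) => s1 t1 /= [xs cs].
have := IH s1; case: (iterate _ _ _ _) => s2 t2 /= [xs2 cs2]; split=> [y|A] ny.
  rewrite xs2 // xs; last by move: ny; rewrite negb_or => /andP[].
  by rewrite /=; move: ny; rewrite negb_or => /andP[/negPf ->].
by rewrite cs2 // cs.
Qed.

Lemma exec_frame c s : frame c s (exec c s).1.
Proof.
elim: c s => //=.
- move=> [x|A f1 f2] f s /=; case: (eval s f) => a t1 /=.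
    by split=> //= y /negPf ->.
  case: (eval s f1) => p t2; case: (eval s f2) => q t3 /=.
  by split=> //= B /negPf ->.
- move=> x f s; case: (eval s f) => a t /=.
  by split=> //= y /negPf ->.
- move=> c1 IH1 c2 IH2 s; have := IH1 s; case: (exec c1 s) => s1 t1 /= [xs1 cs1].
  have := IH2 s1; case: (exec c2 s1) => s2 t2 /= [xs2 cs2].
  by split=> [y|A] /=; rewrite negb_or => /andP[n1 n2]; rewrite ?xs2 ?cs2 // ?xs1 ?cs1.
- move=> f c1 IH1 c2 IH2 s; case: (eval s f) => a t /=.
  have := IH1 s; have := IH2 s; case: (a != 0).
    case: (exec c1 s) => s1 t1 /= _ [xs1 cs1].
    by split=> [y|A] /=; rewrite negb_or => /andP[n1 n2]; rewrite ?xs1 ?cs1.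
  case: (exec c2 s) => s1 t1 /= [xs1 cs1] _.
  by split=> [y|A] /=; rewrite negb_or => /andP[n1 n2]; rewrite ?xs1 ?cs1.
- move=> x f1 f2 c IH s; case: (eval s f1) => lo t1; case: (eval s f2) => hi t2.
  have := iterate_frame x (iota lo (hi.+1 - lo)) s IH.
  by case: (iterate _ _ _ _).
- move=> x f1 f2 c IH s; case: (eval s f1) => hi t1; case: (eval s f2) => lo t2.
  have := iterate_frame x (rev (iota lo (hi.+1 - lo))) s IH.
  by case: (iterate _ _ _ _).
Qed.

Definition runs (c : cmd) (s : state) (t : nat) (Q : state -> Prop) : Prop :=
  Q (exec c s).1 /\ (exec c s).2 <= t.

(** The frame is handed out here and in [runs_seq], [runs_for] and [runs_down], so that
postconditions and invariants need only mention what changes. *)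
Lemma runs_weaken c s t t' (Q Q' : state -> Prop) :
  runs c s t Q -> t <= t' -> (forall s', Q s' -> frame c s s' -> Q' s') -> runs c s t' Q'.
Proof.
move=> [q le_t] le_tt' imp; split; last exact: leq_trans le_tt'.
exact: imp (exec_frame c s).
Qed.

Lemma runs_assign l f s (Q : state -> Prop) :
  Q (store s l (eval s f).1).1 ->
  runs (Assign l f) s ((eval s f).2 + (store s l (eval s f).1).2) Q.
Proof. by rewrite /runs /=; case: (eval s f) => a t /=; case: (store s l a). Qed.

Lemma runs_seq c1 c2 s t1 t2 (R Q : state -> Prop) :
  runs c1 s t1 R -> (forall s', R s' -> frame c1 s s' -> runs c2 s' t2 Q) ->
  runs (Seq c1 c2) s (t1 + t2) Q.
Proof.
move=> [r le1] H; have := H _ r (exec_frame c1 s); rewrite /runs /=.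
case: (exec c1 s) r le1 => s1 u1 /= r le1 [].
by case: (exec c2 s1) => s2 u2 /= q le2; split; rewrite ?leq_add.
Qed.

Lemma runs_assign_seq l f c s t (Q : state -> Prop) :
  runs c (store s l (eval s f).1).1 t Q ->
  runs (Seq (Assign l f) c) s
    ((eval s f).2 + (store s l (eval s f).1).2 + t) Q.
Proof.
move=> H; apply: (@runs_seq _ _ _ _ _ (eq (store s l (eval s f).1).1)).
  exact: runs_assign.
by move=> s' <-.
Qed.

(** The conclusion must hold for every admissible value, since the stream of choices is
arbitrary. *)
Lemma runs_choose x f s (Q : state -> Prop) :
  0 < (eval s f).1 ->
  (forall r, 0 < r <= (eval s f).1 -> Q (set_scalar (next_choice s) x r)) ->
  runs (Choose x f) s (eval s f).2.+2 Q.
Proof.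
rewrite /runs /=; case: (eval s f) => m t /= m_gt0 H; split=> //.
by apply: H; rewrite ltn_pmod.
Qed.

Lemma runs_if f c1 c2 s t (Q : state -> Prop) :
  ((eval s f).1 != 0 -> runs c1 s t Q) ->
  ((eval s f).1 = 0 -> runs c2 s t Q) ->
  runs (If f c1 c2) s ((eval s f).2 + t).+1 Q.
Proof.
rewrite /runs /=; case: (eval s f) => a u /=; case: eqP => [a0 _ /(_ a0)|_ /(_ isT) + _] /=.
  by case: (exec c2 s) => s' t' /= [q le_t]; rewrite ltnS leq_add2l.
by case: (exec c1 s) => s' t' /= [q le_t]; rewrite ltnS leq_add2l.
Qed.

Lemma iterate_inv c x r s t (I : nat -> state -> Prop) (Fr : state -> Prop) :
  Fr s -> I 0 s ->
  (forall s1 s2 i, Fr s1 -> frame c (set_scalar s1 x i) s2 -> Fr s2) ->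
  (forall m s', m < size r -> Fr s' -> I m s' ->
     runs c (set_scalar s' x (nth 0 r m)) t (I m.+1)) ->
  I (size r) (iterate (exec c) x r s).1 /\
  (iterate (exec c) x r s).2 <= size r * (t + 3) + 1.
Proof.
move=> Frs I0 Frc; elim: r s I Frs I0 => //= i r IH s I Frs I0 H.
have /= [I1 le1] := H 0 s isT Frs I0.
have Fr1 := Frc _ _ _ Frs (exec_frame c (set_scalar s x i)).
case: (exec c _) I1 le1 Fr1 => s1 t1 /= I1 le1 Fr1.
have [] := IH s1 (fun m => I m.+1) Fr1 I1.
  by move=> m s' lt_m; exact: (H m.+1 s' lt_m).
by case: (iterate _ _ _ _) => s2 t2 /= I2 le2; split=> //; lia.
Qed.

(** Increasing and decreasing loops with the same counter and body have the same frame,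
whatever their bounds; the loop [c'] stands for all of them. *)
Lemma frame_step x c s s1 s2 i (c' := For x 0 0 c) :
  frame c' s s1 -> frame c (set_scalar s1 x i) s2 -> frame c' s s2.
Proof.
move=> [xs1 cs1] [xs2 cs2]; split=> [y|A] /= ny; last by rewrite cs2 //= cs1.
move: (ny); rewrite negb_or => /andP[/negPf nxy nc].
by rewrite xs2 //= nxy xs1.
Qed.

(** [I m] is the invariant after [m] iterations; as the counter then has the value
[lo + m], it takes the place of a condition on the counter. *)
Lemma runs_for x f1 f2 c s t lo hi (I : nat -> state -> Prop) :
  (eval s f1).1 = lo -> (eval s f2).1 = hi -> I 0 s ->
  (forall m s', m < hi.+1 - lo -> I m s' -> frame (For x f1 f2 c) s s' ->
     runs c (set_scalar s' x (lo + m)) t (I m.+1)) ->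
  runs (For x f1 f2 c) s
    ((eval s f1).2 + (eval s f2).2 + ((hi.+1 - lo) * (t + 3) + 1)) (I (hi.+1 - lo)).
Proof.
rewrite /runs /=; case: (eval s f1) => _ t1 /= ->; case: (eval s f2) => _ t2 /= -> I0 H.
set r := iota _ _.
have sr : size r = hi.+1 - lo by rewrite size_iota.
have [] := @iterate_inv c x r s t I (frame (For x f1 f2 c) s) (frame_refl _ _) I0.
- by move=> s1 s2 i; apply: frame_step.
- by move=> m s'; rewrite sr => lt_m F Im; rewrite nth_iota //; apply: H.
by rewrite sr; case: (iterate _ _ _ _) => s2 u /= ? ?; split=> //; rewrite leq_add2l.
Qed.

Lemma runs_down x f1 f2 c s t lo hi (I : nat -> state -> Prop) :
  (eval s f1).1 = hi -> (eval s f2).1 = lo -> I 0 s ->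
  (forall m s', m < hi.+1 - lo -> I m s' -> frame (Down x f1 f2 c) s s' ->
     runs c (set_scalar s' x (hi - m)) t (I m.+1)) ->
  runs (Down x f1 f2 c) s
    ((eval s f1).2 + (eval s f2).2 + ((hi.+1 - lo) * (t + 3) + 1)) (I (hi.+1 - lo)).
Proof.
rewrite /runs /=; case: (eval s f1) => _ t1 /= ->; case: (eval s f2) => _ t2 /= -> I0 H.
set r := rev _.
have sr : size r = hi.+1 - lo by rewrite size_rev size_iota.
have [] := @iterate_inv c x r s t I (frame (Down x f1 f2 c) s) (frame_refl _ _) I0.
- by move=> s1 s2 i; apply: frame_step.
- move=> m s'; rewrite sr => lt_m F Im.
  rewrite nth_rev ?size_iota // nth_iota; last by lia.
  have -> : lo + (hi.+1 - lo - m.+1) = hi - m by lia.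
  exact: H.
by rewrite sr; case: (iterate _ _ _ _) => s2 u /= ? ?; split=> //; rewrite leq_add2l.
Qed.

(** * Arrays and lists of vertices *)

(** Lists are stored from position 1 on. *)
Definition row (s : state) (A : arr) (p c : nat) : seq nat :=
  [seq cells s A p q | q <- iota 1 c].

Lemma iota_rcons a m : iota a m.+1 = rcons (iota a m) (a + m).
Proof. by rewrite -addn1 iotaD cats1. Qed.

Lemma sum_iota1 m (F : nat -> nat) : \sum_(q <- iota 1 m) F q = \sum_(j < m) F j.+1.
Proof.
by rewrite (iotaDl 1 0 m) big_map -(big_mkord xpredT (fun j => F j.+1)) /index_iota subn0.
Qed.

Lemma all_iota1 m (P : pred nat) :
  reflect (forall i : 'I_m, P i.+1) (all P (iota 1 m)).
Proof.
apply: (iffP allP) => H i; first by apply: H; rewrite mem_iota; have := ltn_ord i; lia.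
rewrite mem_iota => /andP[i_gt0 lt_i]; have lt_i' : i.-1 < m by lia.
by have := H (Ordinal lt_i'); rewrite /= prednK.
Qed.

Lemma row_rcons s A p c : row s A p c.+1 = rcons (row s A p c) (cells s A p c.+1).
Proof. by rewrite /row iota_rcons map_rcons. Qed.

Lemma row_ext s s' A p c :
  (forall q, 0 < q <= c -> cells s A p q = cells s' A p q) -> row s A p c = row s' A p c.
Proof. by move=> eq_s; apply/eq_in_map=> q; rewrite mem_iota => q_c; apply: eq_s; lia. Qed.

Lemma size_row s A p c : size (row s A p c) = c.
Proof. by rewrite size_map size_iota. Qed.

Lemma mem_row s A p c r : 0 < r <= c -> cells s A p r \in row s A p c.
Proof. by move=> r_c; apply/map_f; rewrite mem_iota; lia. Qed.

(** A set of vertices as it is stored in memory: in increasing order, the vertex [u]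
being represented by [u.+1]. *)
Definition listing (n : nat) (A : {set 'I_n}) : seq nat :=
  [seq (nat_of_ord u).+1 | u <- enum A].

Lemma size_listing n (A : {set 'I_n}) : size (listing A) = #|A|.
Proof. by rewrite size_map cardE. Qed.

Lemma mem_listing n (A : {set 'I_n}) (u : 'I_n) : (u.+1 \in listing A) = (u \in A).
Proof. by rewrite (mem_map (f := fun v : 'I_n => v.+1)) ?mem_enum // => v w [/val_inj]. Qed.

Lemma listingP n (A : {set 'I_n}) q :
  q \in listing A -> exists2 u : 'I_n, u \in A & q = u.+1.
Proof. by case/mapP=> u; rewrite mem_enum => Au ->; exists u. Qed.

Lemma uniq_listing n (A : {set 'I_n}) : uniq (listing A).
Proof. by rewrite map_inj_uniq ?enum_uniq // => v w [/val_inj]. Qed.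

(** The loops that collect vertices run through [1], ..., [n], so their result is
determined by the set that they collect. *)
Lemma filter_listing n (A : {set 'I_n}) (P : pred nat) :
  (forall u : 'I_n, P u.+1 = (u \in A)) -> [seq q <- iota 1 n | P q] = listing A.
Proof.
move=> PA; rewrite /listing (iotaDl 1 0 n) -val_enum_ord -map_comp filter_map.
by congr map; rewrite [RHS]/enum_mem -enumT; apply: eq_filter => u /=; rewrite add1n PA.
Qed.

(** Deleting an entry of a list by overwriting it with the last one; the case where it
is the last one itself is included. *)
Lemma row_pick s s' A p r i : 0 < r <= i.+1 ->
  (forall q, cells s' A p q = if r == q then cells s A p i.+1 else cells s A p q) ->
  perm_eq (cells s A p r :: row s' A p i) (row s A p i.+1).
Proof.
move=> r_le s'E; rewrite row_rcons perm_sym perm_rcons perm_sym.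
have [r_i | r_small] : r = i.+1 \/ 0 < r <= i by lia.
  rewrite r_i perm_cons (row_ext (s' := s)) // => q q_le; rewrite s'E r_i ifN //; lia.
have r_in : r \in iota 1 i by rewrite mem_iota; lia.
set t := rem r (iota 1 i).
have rows (f : nat -> nat) : perm_eq [seq f q | q <- iota 1 i] (f r :: map f t).
  exact: perm_map (perm_to_rem r_in).
have same : map (cells s' A p) t = map (cells s A p) t.
  apply/eq_in_map=> q; rewrite mem_rem_uniq ?iota_uniq // inE s'E => /andP[neq _].
  by rewrite eq_sym (negPf neq).
apply: (@perm_trans _ [:: cells s A p r, cells s A p i.+1 & map (cells s A p) t]).
  by rewrite perm_cons /row (permPl (rows _)) s'E eqxx same.
rewrite (perm_catCA [:: _] [:: _]) /= perm_cons perm_sym.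
exact: rows.
Qed.

(** * Completeness test and initialization *)

Lemma holds_input_frame k n (e : rel 'I_n) c s s' :
  ~~ [|| assigns c Vn, assigns c Vk | writes c Adj] ->
  holds_input k e s -> frame c s s' -> holds_input k e s'.
Proof.
rewrite !negb_or => /and3P[nn nk nA] [sn sk sA] [xs cs].
by split; rewrite ?xs ?cs.
Qed.

Section Initialization.

Variables (k n : nat) (e : rel 'I_n).

Lemma test_complete_runs s : 0 < n -> holds_input k e s ->
  runs test_complete s (40 * n ^ 2)
    (fun s' => scalars s' Vcomplete = [forall i : 'I_n, forall j : 'I_n, (i < j) ==> e i j]).
Proof.
move=> n_gt0 inp.
pose adj a b := cells s Adj a b != 0.
pose row_complete a p := all (adj a) (iota a.+1 p).
pose rows_complete m := all (fun a => row_complete a (n - a)) (iota 1 m).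
eapply runs_weaken.
- apply: runs_assign_seq => /=.
  apply: (@runs_for _ _ _ _ _ (20 * n) 1 n
            (fun m s' => scalars s' Vcomplete = rows_complete m)) => //=.
  + by case: inp.
  move=> m s1 lt_m I1 F1.
  have vn : scalars s1 Vn = n by rewrite F1.1 //; case: inp.
  eapply runs_weaken.
  + apply: (@runs_for _ _ _ _ _ 12 m.+2 n (fun p s' => scalars s' Vcomplete =
     rows_complete m && row_complete m.+1 p)) => //=.
    * by rewrite add1n addn1.
    * by rewrite I1 andbT.
    move=> p s2 lt_p I2 F2.
    have adjE : cells s2 Adj (scalars s2 Vi) (m.+2 + p) = cells s Adj m.+1 (m.+2 + p).
      by rewrite F2.1 // F2.2 // F1.2.
    rewrite /row_complete iota_rcons all_rcons andbCA -/(row_complete _ _).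
    eapply runs_weaken.
    - apply: (@runs_if _ _ _ _ 2 (fun s' => scalars s' Vcomplete =
         adj m.+1 (m.+2 + p) && (rows_complete m && row_complete m.+1 p))) => /=.
      + by rewrite adjE eqb0 negbK => /eqP a0; split; rewrite //= /adj a0.
      + by rewrite adjE => /eqP; rewrite eqb0 => a0; split; rewrite //= I2 /adj a0.
    - by [].
    - by [].
  + by move=> /=; lia.
  + by move=> s' -> _; rewrite /rows_complete iota_rcons all_rcons add1n subSS andbC.
- by move=> /=; nia.
move=> s' -> _; congr nat_of_bool; rewrite subn1.
have adjE (i j : 'I_n) : adj i.+1 j.+1 = e i j.
  by case: inp => _ _; rewrite /adj => ->; case: e.
apply/all_iota1/forallP => /= H i.
  apply/forallP=> j; apply/implyP=> lt_ij; rewrite -adjE; apply: (allP (H i)).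
  by rewrite mem_iota; have := ltn_ord j; lia.
apply/allP=> j; rewrite mem_iota => j_i; have lt_j : j.-1 < n by lia.
have := implyP (forallP (H i) (Ordinal lt_j)); rewrite -adjE /= prednK; last by lia.
by apply; lia.
Qed.

(** The current graph is the whole graph, and all vertices are candidates for the last
label. *)
Definition initialized (s : state) : Prop :=
  [/\ cells s Nsize 0 n.+1 = n, row s N n.+1 n = iota 1 n,
      forall u : 'I_n, cells s Alive 0 u.+1 = 1,
      forall u : 'I_n, cells s Deg 0 u.+1 = degree e u &
      forall u w : 'I_n, cells s D u.+1 w.+1 = 0].

Lemma initialize_runs s : 0 < n -> holds_input k e s ->
  runs initialize s (80 * n ^ 2) initialized.
Proof.
move=> n_gt0 inp; have vn0 : scalars s Vn = n by case: inp.
pose adj_sum q c := \sum_(w <- iota 1 c) cells s Adj q w.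
eapply runs_weaken.
- apply: runs_assign_seq => /=.
  apply: (@runs_for _ _ _ _ _ (50 * n) 1 n
            (fun m s' => cells s' Nsize 0 n.+1 = n /\ forall q, 0 < q <= m ->
               [/\ cells s' N n.+1 q = q, cells s' Alive 0 q = 1,
                   cells s' Deg 0 q = adj_sum q n &
                   forall w, 0 < w <= n -> cells s' D q w = 0])) => //=.
  + by split=> [|q]; [rewrite vn0 addn1 eqxx | lia].
  move=> m s1 lt_m [I1s I1] F1.
  have vn : scalars s1 Vn = n by rewrite F1.1.
  eapply runs_weaken => [||s2 I2 _]; last exact: I2.
    do 3!apply: runs_assign_seq => /=.
    eapply runs_weaken.
  + apply: (@runs_for _ _ _ _ _ 30 1 n (fun p s' =>
      [/\ forall q, q != m.+1 -> cells s' Deg 0 q = cells s1 Deg 0 q,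
          forall q w, q != m.+1 -> cells s' D q w = cells s1 D q w,
          cells s' Deg 0 m.+1 = adj_sum m.+1 p &
          forall w, 0 < w <= p -> cells s' D m.+1 w = 0])) => //=.
    * split=> //=.
      - by move=> q nq; rewrite ifN // eq_sym.
      - by rewrite add1n eqxx /adj_sum big_nil.
      - by move=> w; lia.
    move=> p s2 lt_p [I2a I2b I2c I2d] F2.
    have vu : scalars s2 Vu = m.+1 by rewrite F2.1.
    have adjE q w : cells s2 Adj q w = cells s Adj q w by rewrite F2.2 //= F1.2.
    split => //=; rewrite vu adjE; split=> [q nq|q w nq||w lt_w].
    * by rewrite ifN ?I2a // eq_sym.
    * by rewrite ifN ?I2b // eq_sym (negPf nq).
    * by rewrite eqxx /adj_sum iota_rcons big_rcons /= I2c addnC.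
    * by rewrite eqxx; case: eqP => //= nw; apply: I2d; lia.
  + exact: leqnn.
  + move=> s2; rewrite subn1 => -[I2a I2b I2c I2d] F2.
    have Ncell q : cells s2 N n.+1 q = if q == m.+1 then m.+1 else cells s1 N n.+1 q.
      by rewrite F2.2 //= vn addn1 eqxx eq_sym add1n.
    have Acell q : cells s2 Alive 0 q = if q == m.+1 then 1 else cells s1 Alive 0 q.
      by rewrite F2.2 //= eq_sym add1n.
    split=> [|q q_le]; first by rewrite F2.2.
    have [->|neq] := eqVneq q m.+1; first by rewrite Ncell Acell eqxx.
    have [|Nq Aq Dq dq] := I1 q; first by lia.
    rewrite Ncell Acell I2a // (negPf neq); split=> // w lt_w.
    by rewrite I2b // dq.
  + by move=> /=; lia.
- by move=> /=; nia.
rewrite subn1 => s' [I0 I1] _; split=> //.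
- apply: (@eq_from_nth _ 0); rewrite ?size_map // => q.
  rewrite size_iota => lt_q; rewrite (nth_map 0) ?size_iota // nth_iota //.
  by have [->] := I1 q.+1 lt_q.
- by move=> u; have [] := I1 u.+1 (ltn_ord u).
- move=> u; have [_ _ -> _] := I1 u.+1 (ltn_ord u).
  rewrite /adj_sum sum_iota1 /degree -sum1_card [RHS]big_mkcond /=.
  by apply: eq_bigr => w _; rewrite inE; case: inp => _ _ ->; case: (e u w).
- by move=> u w; have [_ _ _ ->] := I1 u.+1 (ltn_ord u); rewrite ?ltn_ord.
Qed.
End Initialization.

(** * Elimination of leaves and labeling *)

(** The two loops in the body of [eliminate], named to be verified separately. *)
Definition candidate_loop : cmd := (
    FOR Vt FROM 1 TO Nsize@[Vi + 1] LOOP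
      Vu <~ N@[Vi + 1, Vt];;
      IF Deg@[Vu] == Vk THEN
        Vcnt <~ Vcnt + 1;;
        Cand@[Vcnt] <~ Vu
      ELSE Skip FI
    POOL)%prog.

Lemma candidate_loop_runs s i c k :
  scalars s Vi = i -> scalars s Vk = k -> scalars s Vcnt = 0 -> cells s Nsize 0 i.+1 = c ->
  runs candidate_loop s (40 * c + 20)
    (fun s' => row s' Cand 0 (scalars s' Vcnt) =
               [seq q <- row s N i.+1 c | cells s Deg 0 q == k]).
Proof.
move=> vi vk vcnt sz; eapply runs_weaken.
- apply: (@runs_for _ _ _ _ _ 30 1 c (fun m s' => row s' Cand 0 (scalars s' Vcnt) =
               [seq q <- row s N i.+1 m | cells s Deg 0 q == k])) => //.
  + by rewrite /= vi addn1.
  + by rewrite vcnt.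
  move=> m s1 lt_m I1 F1; cbv beta; rewrite row_rcons filter_rcons.
  have vi1 : scalars s1 Vi = i by rewrite F1.1.
  have vk1 : scalars s1 Vk = k by rewrite F1.1.
  have Nq q : cells s1 N i.+1 q = cells s N i.+1 q by rewrite F1.2.
  have Dq q : cells s1 Deg 0 q = cells s Deg 0 q by rewrite F1.2.
  eapply runs_weaken => [||s2 I2 _]; last exact: I2.
    apply: runs_assign_seq => /=.
    apply: (@runs_if _ _ _ _ 10); rewrite /= vi1 vk1 addn1 add1n Dq Nq.
      rewrite eqb0 negbK => deg_k; split=> //=.
      rewrite deg_k addn1 row_rcons /= eqxx; congr rcons.
        by rewrite -I1; apply: row_ext => q q_le /=; rewrite ifN //; lia.
    by move=> /eqP; rewrite eqb0 => /negPf deg_k; split=> //=; rewrite deg_k.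
  by [].
- by move=> /=; lia.
by rewrite subn1.
Qed.

Definition neighbor_loop : cmd := (
    FOR Vu FROM 1 TO Vn LOOP
      IF Alive@[Vu] && Adj@[Vx, Vu] THEN
        Vcnt <~ Vcnt + 1;;
        N@[Vi, Vcnt] <~ Vu;;
        Deg@[Vu] <~ Deg@[Vu] - 1
      ELSE Skip FI
    POOL)%prog.

Lemma neighbor_loop_runs s i x n
    (nbr := fun q => (cells s Alive 0 q != 0) && (cells s Adj x q != 0)) :
  scalars s Vi = i -> scalars s Vx = x -> scalars s Vcnt = 0 -> scalars s Vn = n ->
  runs neighbor_loop s (40 * n + 20)
    (fun s' => [/\ row s' N i (scalars s' Vcnt) = [seq q <- iota 1 n | nbr q],
                   forall p q, p != i -> cells s' N p q = cells s N p q &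
                   forall q, 0 < q <= n -> cells s' Deg 0 q = cells s Deg 0 q - nbr q]).
Proof.
move=> vi vx vcnt vn; eapply runs_weaken.
- apply: (@runs_for _ _ _ _ _ 30 1 n (fun m s' =>
               [/\ row s' N i (scalars s' Vcnt) = [seq q <- iota 1 m | nbr q],
                   forall p q, p != i -> cells s' N p q = cells s N p q &
                   forall q,
                     cells s' Deg 0 q = cells s Deg 0 q - (nbr q && (0 < q <= m))])) => //.
  + by rewrite vcnt; split=> // q; case: q => [|q] /=; rewrite andbF subn0.
  move=> m s1 lt_m [I1a I1b I1c] F1; cbv beta; rewrite iota_rcons filter_rcons add1n.
  have vi1 : scalars s1 Vi = i by rewrite F1.1.
  have vx1 : scalars s1 Vx = x by rewrite F1.1.
  have Aq p q : cells s1 Alive p q = cells s Alive p q by rewrite F1.2.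
  have Eq p q : cells s1 Adj p q = cells s Adj p q by rewrite F1.2.
  eapply runs_weaken => [||s2 I2 _]; last exact: I2.
    apply: (@runs_if _ _ _ _ 20); rewrite /= vx1 Aq Eq -/(nbr _).
      rewrite eqb0 negbK => nb; split=> //=; rewrite nb vi1 addn1.
      split=> [|p q np|q].
      - rewrite row_rcons /= !eqxx; congr rcons.
        by rewrite -I1a; apply: row_ext => q q_le /=; rewrite eqxx ifN //; lia.
      - by rewrite eq_sym (negPf np) I1b.
      - case: eqP => [<-|neq]; rewrite I1c.
          by rewrite nb ltnn subn0 leqnn.
        by congr (_ - (_ && _)); lia.
    move=> /eqP; rewrite eqb0 => /negPf nb; split=> //=; rewrite nb; split=> // q.
    rewrite I1c; have [->|neq] := eqVneq q m.+1; first by rewrite nb.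
    by congr (_ - (_ && _)); lia.
  by [].
- by move=> /=; lia.
rewrite subn1 /= => s' [Ia Ib Ic] _; split=> // q q_n.
by rewrite Ic q_n andbT.
Qed.

Section Labeling.

Variables (k n : nat) (e : rel 'I_n).
Hypotheses (sym_e : symmetric e) (irr_e : irreflexive e).

(** A labeling under construction assigns 0 to the vertices still without label.  Labels
are given out from [n] downwards, so a vertex labeled later gets a smaller label,
and unlabeled vertices count as earlier than all labeled ones. *)
Definition unlabeled (lab : 'I_n -> nat) : {set 'I_n} := [set u | lab u == 0].

(** The labels above [i] have been given out. *)
Record partial_labeling (s : state) (i : nat) (lab : 'I_n -> nat) : Prop := {
  label_range : forall u, lab u = 0 \/ i < lab u <= n;
  card_unlabeled : #|unlabeled lab| = i;
  label_vertex : forall u, 0 < lab u -> cells s V 0 (lab u) = u.+1;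
  label_earlier : forall u, k.+1 < lab u ->
    [/\ clique e (earlier e lab u), cells s Nsize 0 (lab u) = k &
        row s N (lab u) k = listing (earlier e lab u)] }.

Definition relabel (lab : 'I_n -> nat) (x : 'I_n) (i : nat) : 'I_n -> nat :=
  fun u => if u == x then i else lab u.

Lemma unlabeled_relabel lab x i : 0 < i -> unlabeled (relabel lab x i) = unlabeled lab :\ x.
Proof.
move=> i_gt0; apply/setP=> u; rewrite !inE /relabel.
by case: (eqVneq u x) => //= _; rewrite eqn0Ngt i_gt0.
Qed.

(** Giving the label [i] to [x] does not affect the earlier neighbors of the vertices
already labeled, and those of [x] are its neighbors in the current graph.  The lemma
serves both the elimination and the labeling of the last [k + 1] vertices, where
lists of earlier neighbors are not recorded. *)
Lemma label_step s s' i lab x :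
  partial_labeling s i lab -> 0 < i -> x \in unlabeled lab ->
  cells s' V 0 i = x.+1 ->
  (forall q, i < q -> [/\ cells s' V 0 q = cells s V 0 q,
     cells s' Nsize 0 q = cells s Nsize 0 q & forall r, cells s' N q r = cells s N q r]) ->
  (k.+1 < i ->
    [/\ clique e (nbrs e (unlabeled lab) x), cells s' Nsize 0 i = k &
        row s' N i k = listing (nbrs e (unlabeled lab) x)]) ->
  partial_labeling s' i.-1 (relabel lab x i).
Proof.
move=> [rng crd vtx ear] i_gt0 Ux Vx same new.
have lab_x : lab x = 0 by move: Ux; rewrite inE => /eqP.
have i_n : i <= n by rewrite -crd -[n in _ <= n]card_ord max_card.
have earlier_x : earlier e (relabel lab x i) x = nbrs e (unlabeled lab) x.
  apply/setP=> w; rewrite !inE /relabel eqxx andbC; case: (eqVneq w x) => [->|_].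
    by rewrite irr_e !andbF.
  by congr (_ && _); case: (rng w); lia.
have earlier_old u : u != x -> 0 < lab u -> earlier e (relabel lab x i) u = earlier e lab u.
  move=> neq lu; apply/setP=> w; rewrite !inE /relabel (negPf neq); congr (_ && _).
  by case: eqP => // ->; case: (rng u); lia.
split=> [u||u|u].
- by rewrite /relabel; case: eqP => _; [right; lia | case: (rng u); lia].
- by rewrite unlabeled_relabel //; move: crd; rewrite (cardsD1 x) Ux => <-.
- rewrite {1 2}/relabel; case: eqP => [-> //|_] lu.
  by have [|-> _ _] := same (lab u); [case: (rng u); lia | exact: vtx].
- have [->|neq] := eqVneq u x; first by rewrite earlier_x {1 2 3}/relabel eqxx.
  rewrite {1}/relabel (negPf neq) => lu; rewrite earlier_old //; last exact: leq_ltn_trans lu.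
  rewrite /relabel (negPf neq).
  have [|_ -> Neq] := same (lab u); first by case: (rng u); lia.
  have [cl sz rw] := ear u lu; split=> //.
  by rewrite -rw; apply: row_ext => q _.
Qed.

(** The invariant of the elimination when the label [i] is about to be given.  The set
[A] in [elim_next] is the list in which the next vertex is searched; that it
contains a leaf is what keeps the set of candidates nonempty. *)
Record elim_state (s : state) (i : nat) (lab : 'I_n -> nat) : Prop := {
  elim_partial : partial_labeling s i lab;
  elim_alive : forall u : 'I_n, cells s Alive 0 u.+1 = (u \in unlabeled lab);
  elim_degree : forall u, u \in unlabeled lab ->
    cells s Deg 0 u.+1 = #|nbrs e (unlabeled lab) u|;
  elim_ktree : ktree_on e k (unlabeled lab);
  elim_two : k.+1 < i -> #|leaves e k (unlabeled lab)| = 2;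
  elim_next : exists A : {set 'I_n},
    [/\ A \subset unlabeled lab, cells s Nsize 0 i.+1 = #|A|,
        row s N i.+1 #|A| = listing A &
        k.+1 < i -> exists2 u, u \in A & u \in leaves e k (unlabeled lab)] }.

Lemma elim_init s : holds_input k e s -> initialized e s ->
  ktree e k -> #|leaves e k [set: 'I_n]| = 2 -> elim_state s n (fun=> 0).
Proof.
move=> inp [sz rowN al dg _] kt two.
have unl : unlabeled (fun=> 0) = [set: 'I_n] by apply/setP=> u; rewrite !inE.
have nbrsT u : nbrs e setT u = [set y | e u y] by apply/setP=> y; rewrite !inE.
split; rewrite ?unl //.
- by split=> // [u|]; [left | rewrite unl cardsT card_ord].
- by move=> u; rewrite al inE.
- by move=> u _; rewrite dg nbrsT.
exists setT; rewrite cardsT card_ord; split=> //.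
  by rewrite rowN -[LHS]filter_predT; apply: filter_listing => u; rewrite inE.
move=> lt_n; have /card_gt0P[u Lu] : 0 < #|leaves e k [set: 'I_n]| by rewrite two.
by exists u.
Qed.

(** The candidates are the leaves in [A], whatever is chosen among them is a leaf [x] of
the current graph, and [linear_remove_leaf] restores the invariant without [x]. *)
Lemma eliminate_body_runs s i lab :
  holds_input k e s -> scalars s Vi = i -> k.+1 < i -> elim_state s i lab ->
  runs (Vcnt <~ 0;;
    candidate_loop;;
    CHOOSE Vpos UPTO Vcnt;;
    Vx <~ Cand@[Vpos];;
    V@[Vi] <~ Vx;;
    Vcnt <~ 0;;
    neighbor_loop;;
    Nsize@[Vi] <~ Vcnt;;
    Alive@[Vx] <~ 0)%prog s (90 * n + 90)
  (fun s' => exists lab', elim_state s' i.-1 lab').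
Proof.
move=> inp vi lt_i [part al dg kt two [A [sA szA rowA next]]].
have [u0 Au0 Lu0] := next lt_i; have two_i := two lt_i.
have [rng crd _ _] := part.
have i_n : i <= n by rewrite -crd -[n in _ <= n]card_ord max_card.
have A_n : #|A| <= n by rewrite -[n in _ <= n]card_ord max_card.
have [vn vk adj] := inp.
eapply runs_weaken => [||s' I' _]; last exact: I'.
  apply: runs_assign_seq => /=.
  apply: (@runs_seq _ _ _ (40 * n + 20) (3 + (40 * n + 50))).
    eapply runs_weaken => [||s' I' _]; last exact: I'.
      exact: (@candidate_loop_runs _ i #|A| k).
    by rewrite leq_add2r leq_mul2l.
  move=> s1 I1 F1.
  have cellsE B : ~~ writes candidate_loop B -> cells s1 B = cells s B by exact: F1.2.
  have candP (u : 'I_n) : (u.+1 \in row s1 Cand 0 (scalars s1 Vcnt)) =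
                 (u \in A) && (u \in leaves e k (unlabeled lab)).
    rewrite I1 mem_filter -[row _ _ _ _]/(row s N i.+1 #|A|) rowA mem_listing andbC.
    by case Au: (u \in A) => //=; rewrite inE (subsetP sA) //= dg ?(subsetP sA).
  have cnt_gt0 : 0 < scalars s1 Vcnt.
    by have := candP u0; rewrite Au0 Lu0; case: (scalars s1 Vcnt).
  apply: (@runs_seq _ _ _ 3 (40 * n + 50)).
    apply: (@runs_choose _ _ _ (fun s' => exists2 r, 0 < r <= scalars s1 Vcnt &
                                  s' = set_scalar (next_choice s1) Vpos r)) => //=.
    by move=> r r_le; exists r.
  move=> _ [r r_le ->] _.
  have [x Lx cand_r] : exists2 x : 'I_n,
      x \in leaves e k (unlabeled lab) & cells s1 Cand 0 r = x.+1.
    have in_row := mem_row s1 Cand 0 r_le.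
    have : cells s1 Cand 0 r \in listing A.
      by move: in_row; rewrite I1 mem_filter => /andP[_]; rewrite -rowA.
    case/listingP=> x _ eq_x; exists x => //.
    by move: in_row; rewrite eq_x candP => /andP[].
  eapply runs_weaken => [||s' I' _]; last exact: I'.
  do 3!apply: runs_assign_seq => /=; rewrite cand_r F1.1 //= vi.
  set s2 := set_scalar _ Vcnt 0.
  apply: (@runs_seq _ _ _ (40 * n + 20) 10).
    by apply: (@neighbor_loop_runs s2 i x.+1 n); rewrite /= ?F1.1.
  move=> s3 [I3a I3b I3c] F3; set S := unlabeled lab in kt two_i crd Lx dg al |- *.
  have Sx : x \in S by move: Lx; rewrite inE => /andP[].
  have lt_S : k.+1 < #|S| by rewrite crd.
  have [ktS clX] := ktree_remove_leaf sym_e irr_e kt lt_S Lx.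
  have nbrE (u : 'I_n) :
    (cells s2 Alive 0 u.+1 != 0) && (cells s2 Adj x.+1 u.+1 != 0) = (u \in nbrs e S x).
    by rewrite /= !cellsE // al adj !eqb0 !negbK [RHS]inE.
  have rowX : row s3 N i (scalars s3 Vcnt) = listing (nbrs e S x).
    by rewrite I3a; apply: filter_listing => u; exact: nbrE.
  have cardX : #|nbrs e S x| = k by move: Lx; rewrite inE => /andP[_ /eqP].
  have cnt3 : scalars s3 Vcnt = k by rewrite -cardX -size_listing -rowX size_row.
  have vi3 : scalars s3 Vi = i by rewrite F3.1 //= F1.1.
  have vx3 : scalars s3 Vx = x.+1 by rewrite F3.1.
  have i_gt0 : 0 < i by lia.
  rewrite cnt3 in rowX.
  split=> //=; rewrite cnt3 vi3 vx3; exists (relabel lab x i); split=> /=.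
  - apply: label_step part i_gt0 Sx _ _ _ => /=.
    + by rewrite F3.2 // /s2 /= !eqxx.
    + move=> q lt_iq; have neq : i != q by rewrite neq_ltn lt_iq.
      rewrite F3.2 // [cells s3 Nsize]F3.2 // /s2 /= (negPf neq) !cellsE //; split=> // r'.
      by rewrite I3b 1?eq_sym //= cellsE.
    + by move=> _; rewrite eqxx.
  - move=> u; rewrite unlabeled_relabel // -/S in_setD1.
    have [->|neq] := eqVneq u x; first by rewrite eqxx.
    by rewrite eqSS eq_sym [_ == _](negPf neq) F3.2 //= cellsE // al.
  - move=> u; rewrite unlabeled_relabel // -/S => /setD1P[neq Su].
    rewrite I3c ?ltn_ord // nbrE /= cellsE // dg // (nbrs_setD1 _ _ Sx) inE Su sym_e.
    by rewrite addKn.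
  - by rewrite unlabeled_relabel.
  - move=> lt_i1; rewrite unlabeled_relabel //.
    by have [] := @linear_remove_leaf _ e k sym_e irr_e S x kt _ two_i Lx; rewrite // crd; lia.
  - exists (nbrs e S x); rewrite unlabeled_relabel // prednK // eqxx cardX; split=> //.
    + apply/subsetP=> y; rewrite !inE => /andP[-> xy]; rewrite andbT.
      by apply: contraTneq xy => ->; rewrite irr_e.
    + move=> lt_i1.
      by have [] := @linear_remove_leaf _ e k sym_e irr_e S x kt _ two_i Lx; rewrite // crd; lia.
- by move=> /=; lia.
by move=> /=; lia.
Qed.
Lemma elim_state_cells s s' i lab :
  cells s' = cells s -> elim_state s i lab -> elim_state s' i lab.
Proof.
case: s s' => [sc ce ch] [sc' ce' ch'] /= -> [[? ? ? ?] ? ? ? ? ?].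
by split=> //; split.
Qed.

Lemma eliminate_runs s :
  holds_input k e s -> k.+1 < n -> elim_state s n (fun=> 0) ->
  runs eliminate s (200 * n ^ 2) (fun s' => exists lab, elim_state s' k.+1 lab).
Proof.
move=> inp lt_kn st; have [vn vk _] := inp; eapply runs_weaken.
- apply: (@runs_down _ _ _ _ _ (90 * n + 90) k.+2 n
            (fun m s' => exists lab, elim_state s' (n - m) lab)) => //.
  + by rewrite /= vk addn2.
  + by rewrite subn0; exists (fun=> 0).
  move=> m s1 lt_m [lab st1] F1.
  rewrite subnS; apply: (@eliminate_body_runs _ _ lab) => //.
  + by case: inp => ? ? ?; split; rewrite /= ?F1.1 ?F1.2.
  + by lia.
  + exact: elim_state_cells st1.
- by move=> /=; nia.
move=> s' [lab st'] _; exists lab.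
by have <- : n - (n.+1 - k.+2) = k.+1 by lia.
Qed.

Lemma rest_loop_runs s (S : {set 'I_n}) :
  scalars s Vn = n -> scalars s Vcnt = 0 ->
  (forall u : 'I_n, cells s Alive 0 u.+1 = (u \in S)) ->
  runs (FOR Vu FROM 1 TO Vn LOOP
    IF Alive@[Vu] THEN
      Vcnt <~ Vcnt + 1;;
      Rest@[Vcnt] <~ Vu
    ELSE Skip FI
  POOL)%prog s (30 * n + 10) (fun s' => row s' Rest 0 #|S| = listing S).
Proof.
move=> vn vcnt al; eapply runs_weaken.
- apply: (@runs_for _ _ _ _ _ 20 1 n (fun m s' => row s' Rest 0 (scalars s' Vcnt) =
               [seq q <- iota 1 m | cells s Alive 0 q != 0])) => //.
  + by rewrite vcnt.
  move=> m s1 lt_m I1 F1; cbv beta; rewrite iota_rcons filter_rcons.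
  eapply runs_weaken => [||s2 I2 _]; last exact: I2.
    apply: (@runs_if _ _ _ _ 10); rewrite /= F1.2 // add1n => nz.
      split=> //=; rewrite nz addn1 row_rcons /= eqxx; congr rcons.
      by rewrite -I1; apply: row_ext => q q_le /=; rewrite ifN //; lia.
    by rewrite nz; split.
  by [].
- by move=> /=; lia.
move=> s'; rewrite subn1 /= (@filter_listing _ S) => [rowS _|u].
  have <- : scalars s' Vcnt = #|S| by rewrite -size_listing -rowS size_row.
  exact: rowS.
by rewrite al eqb0 negbK.
Qed.

(** The list of the vertices that remain is consumed in an arbitrary order; throughout,
the vertices with a label at most [k + 1], counting the unlabeled ones, are those
that were left by the elimination. *)
Lemma label_loop_runs s lab :
  scalars s Vk = k -> partial_labeling s k.+1 lab ->
  row s Rest 0 k.+1 = listing (unlabeled lab) ->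
  runs (FOR Vi FROM Vk + 1 DOWNTO 1 LOOP
    CHOOSE Vpos UPTO Vi;;
    V@[Vi] <~ Rest@[Vpos];;
    Rest@[Vpos] <~ Rest@[Vi]
  POOL)%prog s (30 * k + 50)
  (fun s' => exists lab', partial_labeling s' 0 lab' /\
      [set u | lab' u <= k.+1] = unlabeled lab).
Proof.
move=> vk part rowR; eapply runs_weaken.
- apply: (@runs_down _ _ _ _ _ 20 1 k.+1
     (fun m s' => exists lab', [/\ partial_labeling s' (k.+1 - m) lab',
        [set u | lab' u <= k.+1] = unlabeled lab &
        perm_eq (row s' Rest 0 (k.+1 - m)) (listing (unlabeled lab'))])) => //.
  + by rewrite /= vk addn1.
  + rewrite subn0; exists lab; rewrite rowR; split=> //.
    by apply/setP=> u; rewrite !inE; case: (label_range part u); lia.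
  move=> m s1 lt_m [lab1 [part1 small1 rest1]] F1.
  move i_def: (k.+1 - m) part1 rest1 => [|i] part1 rest1; first by lia.
  have -> : k.+1 - m.+1 = i by lia.
  eapply runs_weaken => [||s2 I2 _]; last exact: I2.
    apply: (@runs_seq _ _ _ 3 12).
      apply: (@runs_choose _ _ _ (fun s' => exists2 r, 0 < r <= i.+1 &
                 s' = set_scalar (next_choice (set_scalar s1 Vi i.+1)) Vpos r)) => //=.
      by move=> r r_le; exists r.
    move=> _ [r r_le ->] _.
    have := mem_row s1 Rest 0 r_le.
    rewrite (perm_mem rest1) => /listingP[x Ux rest_r].
    split=> //=; exists (relabel lab1 x i.+1); split.
    + apply: (label_step part1 _ Ux) => //=.
      - by rewrite eqxx.
      - by move=> q lt_iq; rewrite ifN // neq_ltn lt_iq.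
      - by lia.
    + rewrite -small1; apply/setP=> u; rewrite !inE /relabel; case: eqP => // ->.
      by move: Ux; rewrite inE => /eqP ->; lia.
    + rewrite unlabeled_relabel // -(perm_cons x.+1).
      set s2 := (s in row s _ _ _); rewrite -rest_r.
      apply: (@perm_trans _ (row s1 Rest 0 i.+1)).
        exact: row_pick.
      apply: (perm_trans rest1); rewrite rest_r.
      apply: uniq_perm; rewrite /= ?uniq_listing ?mem_listing ?in_setD1 ?eqxx // => q.
      apply/idP/idP=> [/listingP[u Uu ->]|].
        by rewrite inE mem_listing in_setD1 Uu andbT eqSS orbN.
      by rewrite inE => /orP[/eqP->|/listingP[u /setD1P[_ Uu] ->]]; rewrite mem_listing.
  by [].
- by move=> /=; lia.
by move=> s'; rewrite subn1 subnn => -[lab' [? ? _]] _; exists lab'.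
Qed.

(** A k-tree with [k + 1] vertices is a clique. *)
Lemma label_rest_runs s lab :
  holds_input k e s -> elim_state s k.+1 lab -> k < n ->
  runs label_rest s (100 * n)
    (fun s' => exists lab', partial_labeling s' 0 lab' /\ clique e [set u | lab' u <= k.+1]).
Proof.
move=> [vn vk _] [part al _ kt _ _] lt_kn; eapply runs_weaken => [||s' I' _]; last exact: I'.
  apply: runs_assign_seq => /=.
  apply: (@runs_seq _ _ _ (30 * n + 10) (30 * k + 50)).
    exact: (@rest_loop_runs _ (unlabeled lab)).
  move=> s1 I1 F1; rewrite (card_unlabeled part) in I1.
  eapply runs_weaken; first apply: (@label_loop_runs _ lab).
  - by rewrite F1.1.
  - case: part => rng crd vtx ear; split=> // [u lu|u lu]; first by rewrite F1.2 //= vtx.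
    have [cl sz rw] := ear u lu; split; rewrite ?F1.2 //= -rw.
    by apply: row_ext => q _; rewrite F1.2.
  - by [].
  - by [].
  - move=> s2 [lab' [part' small]] _; exists lab'; split=> //; rewrite small.
    by apply: ktree_small kt _; rewrite (card_unlabeled part).
by move=> /=; lia.
Qed.
End Labeling.

(** * Filling in the distances *)

Lemma min_loop_runs s c
    (val := fun t => cells s D (cells s V 0 (scalars s Vl)) (cells s N (scalars s Vi) t)) :
  0 < c -> cells s Nsize 0 (scalars s Vi) = c -> scalars s Vmin = val 1 ->
  runs (FOR Vt FROM 2 TO Nsize@[Vi] LOOP
        Vu <~ D@[V@[Vl], N@[Vi, Vt]];;
        IF Vu <= Vmin THEN Vmin <~ Vu ELSE Skip FI
      POOL)%prog s (40 * c)
    (fun s' => (exists2 t, 0 < t <= c & scalars s' Vmin = val t) /\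
               forall t, 0 < t <= c -> scalars s' Vmin <= val t).
Proof.
move=> c_gt0 sz min1; eapply runs_weaken.
- apply: (@runs_for _ _ _ _ _ 25 2 c (fun m s' =>
       (exists2 t, 0 < t <= m.+1 & scalars s' Vmin = val t) /\
               forall t, 0 < t <= m.+1 -> scalars s' Vmin <= val t)) => //=.
  + by split=> [|t t1]; [exists 1 | have -> : t = 1 by lia]; rewrite ?min1.
  move=> m s1 lt_m [[t0 t0_le mint0] I1] F1.
  eapply runs_weaken => [||s2 I2 _]; last exact: I2.
    apply: runs_assign_seq => /=.
    rewrite !F1.2 //= !F1.1 //= -/(val _).
    apply: (@runs_if _ _ _ _ 10) => /=.
      rewrite eqb0 negbK => le_v; split=> //=; split=> [|t t_le].
        by exists (2 + m) => //; lia.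
      have [->//|neq] := eqVneq t (2 + m).
      by apply: leq_trans le_v (I1 _ _); lia.
    move=> /eqP; rewrite eqb0 -ltnNge => lt_v; split=> //=; split=> [|t t_le].
      by exists t0 => //; lia.
    have [->|neq] := eqVneq t (2 + m); first exact: ltnW.
    by apply: I1; lia.
  by [].
- by move=> /=; lia.
by move=> s'; rewrite subSS subn1 prednK.
Qed.

Section Distances.

Variables (k n : nat) (e : rel 'I_n).
Hypotheses (sym_e : symmetric e) (irr_e : irreflexive e).
Hypothesis connected_e : forall x y, connect e x y.

(** Distinct vertices have distinct labels because the array [V] records only one vertex
for each label; by counting, all labels are used.  From here on the vertex labeled
[i.+1] is [v i]. *)
Lemma labels_bijective s lab : partial_labeling k e s 0 lab ->
  injective lab /\ exists2 v : 'I_n -> 'I_n, bijective v & forall i, lab (v i) = i.+1.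
Proof.
move=> part; have lab_gt0 u : 0 < lab u.
  have := card_unlabeled part; rewrite lt0n => /eqP; rewrite cards_eq0 => /eqP un0.
  by apply/negP=> lu; have := in_set0 u; rewrite -un0 inE lu.
have lab_n u : (lab u).-1 < n by have := lab_gt0 u; case: (label_range part u); lia.
have lab_inj : injective lab.
  move=> u w eq_l; apply: val_inj; apply: succn_inj.
  by rewrite -(label_vertex part (lab_gt0 u)) eq_l (label_vertex part (lab_gt0 w)).
split=> //; pose g u := Ordinal (lab_n u).
have [v gK vK] : bijective g.
  apply: injF_bij => u w [] eq_l; apply: lab_inj.
  by rewrite -(prednK (lab_gt0 u)) eq_l prednK.
exists v; first by exists g.
by move=> i; rewrite -(prednK (lab_gt0 _)) -[(lab _).-1]/(val (g (v i))) vK.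
Qed.

Variables (lab : 'I_n -> nat) (v : 'I_n -> 'I_n).
Hypothesis lab_inj : injective lab.
Hypothesis labK : forall i, lab (v i) = i.+1.
Hypothesis v_bij : bijective v.
Hypothesis clique_earlier : forall x, clique e (earlier e lab x).
Hypothesis clique_small : clique e [set u | lab u <= k.+1].
Hypothesis k_gt0 : 0 < k.
Hypothesis k_n : k < n.

(** The entries of [D] that are correct when the algorithm is about to treat the pair
[(l, i)]: those of the pairs treated before, in the lexicographic order of the
loops, and the diagonal. *)
Definition known (s : state) (l i : nat) : Prop :=
  (forall u : 'I_n, cells s D u.+1 u.+1 = 0) /\
  forall a b : 'I_n, a < b -> a < l \/ a = l :> nat /\ b < i ->
    cells s D (v a).+1 (v b).+1 = distance e (v a) (v b) /\
    cells s D (v b).+1 (v a).+1 = distance e (v a) (v b).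

Lemma known_store s s' (a b : 'I_n) (x := (v a).+1) (y := (v b).+1) :
  a < b -> known s a b ->
  (forall p q, cells s' D p q =
     if (x == p) && (y == q) then distance e (v a) (v b)
     else if (y == p) && (x == q) then distance e (v a) (v b)
     else cells s D p q) ->
  known s' a b.+1.
Proof.
move=> lt_ab [diag pairs] s'E; have v_inj := bij_inj v_bij.
have neq_ab : v a != v b by rewrite (inj_eq v_inj) neq_ltn lt_ab.
split=> [u|a' b' lt_ab' known_ab].
  rewrite s'E !eqSS !(inj_eq val_inj).
  have [<-|_] := eqVneq (v a) u; last by rewrite andbF diag.
  by rewrite [v b == v a]eq_sym (negPf neq_ab) andbF diag.
rewrite !s'E !eqSS !(inj_eq val_inj) !(inj_eq v_inj).
have swapF : (b == a') && (a == b') = false.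
  by apply/negP=> /andP[/eqP eq_b /eqP eq_a]; move: lt_ab lt_ab'; rewrite eq_a eq_b; lia.
rewrite [(a == b') && _]andbC swapF [(b == b') && _]andbC.
have [/andP[/eqP<- /eqP<-] //|neq] := boolP ((a == a') && (b == b')).
apply: pairs lt_ab' _; case: known_ab => [|[eq_a lt_b]]; [by left | right; split=> //].
rewrite ltn_neqAle -ltnS lt_b andbT; apply: contra neq => /eqP/val_inj ->.
by rewrite (val_inj eq_a) !eqxx.
Qed.

(** For an earlier neighbor [v c] of [v b], the entry at [v a] and [v c] is known: the
pair was treated in a previous round of the outer loop if [c < a], earlier in the
same round if [a < c < b], and is on the diagonal if [c = a]. *)
Lemma distance_step s (a b : 'I_n) m :
  known s a b -> a < b ->
  (exists2 t, 0 < t <= k & m = cells s D (v a).+1 (cells s N b.+1 t)) ->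
  (forall t, 0 < t <= k -> m <= cells s D (v a).+1 (cells s N b.+1 t)) ->
  row s N b.+1 k = listing (earlier e lab (v b)) ->
  m.+1 = distance e (v a) (v b).
Proof.
move=> [diag pairs] lt_ab [t t_k mE] m_le rowN; apply/esym.
have before w : w \in earlier e lab (v b) -> cells s D (v a).+1 w.+1 = distance e (v a) w.
  have [g gK vK] := v_bij; rewrite -[w]vK inE !labK ltnS => /andP[_ lt_cb].
  case: (ltngtP a (g w)) => [lt_ac|lt_ca|/val_inj <-].
  - by have [|-> _ //] := pairs a (g w) lt_ac; right.
  - rewrite (distance_sym connected_e sym_e).
    by have [|_ ->] := pairs (g w) a lt_ca; [left | rewrite (distance_sym connected_e sym_e)].
  - by rewrite diag distance_refl.
apply: (distance_min sym_e irr_e connected_e lab_inj clique_earlier).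
- by rewrite !labK ltnS.
- have := mem_row s N b.+1 t_k; rewrite rowN => /listingP[w w_b Nt].
  by exists w; rewrite // -before // mE Nt.
move=> w w_b; rewrite -before //.
have : w.+1 \in row s N b.+1 k by rewrite rowN mem_listing.
by case/mapP=> r; rewrite mem_iota => r_k ->; apply: m_le; lia.
Qed.

(** What [fill_distances] needs to know of the previous phases. *)
Definition labeled (s : state) : Prop :=
  (forall i : 'I_n, cells s V 0 i.+1 = (v i).+1) /\
  (forall i : 'I_n, k < i ->
     cells s Nsize 0 i.+1 = k /\ row s N i.+1 k = listing (earlier e lab (v i))).

Lemma labeled_cells s s' : cells s' V = cells s V -> cells s' N = cells s N ->
  cells s' Nsize = cells s Nsize -> labeled s -> labeled s'.
Proof.
move=> eV eN eZ [lV lN]; split=> [i|i k_i]; rewrite ?eV // eZ.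
by have [-> <-] := lN i k_i; split=> //; apply: row_ext => q _; rewrite eN.
Qed.

(** The vertices labeled up to [k + 1] are pairwise adjacent. *)
Lemma clique_pairs_runs s (a : 'I_n) :
  labeled s -> scalars s Vk = k -> scalars s Vl = a.+1 -> known s a a.+1 ->
  runs (FOR Vi FROM Vl + 1 TO Vk + 1 LOOP
      D@[V@[Vi], V@[Vl]] <~ 1;;
      D@[V@[Vl], V@[Vi]] <~ 1
    POOL)%prog s (40 * k + 40) (fun s' => known s' a (maxn k.+1 a.+1)).
Proof.
move=> lab_s vk vl known0; eapply runs_weaken.
- apply: (@runs_for _ _ _ _ _ 25 a.+2 k.+1 (fun m s' => known s' a (a.+1 + m))).
  + by rewrite /= vl addn1.
  + by rewrite /= vk addn1.
  + by rewrite addn0.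
  move=> m s1 lt_m I1 F1.
  have lt_b : a.+1 + m < n by lia.
  have lab1 : labeled s1 by apply: labeled_cells lab_s; rewrite F1.2.
  have vl1 : scalars s1 Vl = a.+1 by rewrite F1.1.
  have lt_ab : a < Ordinal lt_b by rewrite /=; lia.
  split=> //=; rewrite addnS; apply: (@known_store s1 _ a (Ordinal lt_b)) => //= p q.
  rewrite vl1 -[a.+2 + m]/(Ordinal lt_b).+1 !lab1.1.
  rewrite distance_adjacent //.
    by rewrite (inj_eq (bij_inj v_bij)) neq_ltn lt_ab.
  apply: (elimT (cliqueP _ _) clique_small); rewrite ?inE ?labK /=; try lia.
  by rewrite (inj_eq (bij_inj v_bij)) neq_ltn lt_ab.
- by move=> /=; lia.
move=> s' [diag pairs] _; split=> // x y lt_xy xy; apply: pairs => //; lia.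
Qed.

Lemma later_pairs_runs s (a : 'I_n) (c := maxn k.+1 a.+1) :
  labeled s -> scalars s Vn = n -> scalars s Vl = a.+1 -> scalars s Vw = c -> known s a c ->
  runs (FOR Vi FROM Vw + 1 TO Vn LOOP
      Vmin <~ D@[V@[Vl], N@[Vi, 1]];;
      FOR Vt FROM 2 TO Nsize@[Vi] LOOP
        Vu <~ D@[V@[Vl], N@[Vi, Vt]];;
        IF Vu <= Vmin THEN Vmin <~ Vu ELSE Skip FI
      POOL;;
      D@[V@[Vi], V@[Vl]] <~ Vmin + 1;;
      D@[V@[Vl], V@[Vi]] <~ Vmin + 1
    POOL)%prog s (n * (40 * k + 40) + 10) (fun s' => known s' a n).
Proof.
move=> lab_s vn vl vw known0; eapply runs_weaken.
- apply: (@runs_for _ _ _ _ _ (40 * k + 30) c.+1 n (fun m s' => known s' a (c + m))).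
  + by rewrite /= vw addn1.
  + by rewrite /= vn.
  + by rewrite addn0.
  move=> m s1 lt_m I1 F1.
  have lt_b : c + m < n by lia.
  have lab1 : labeled s1 by apply: labeled_cells lab_s; rewrite F1.2.
  have vl1 : scalars s1 Vl = a.+1 by rewrite F1.1.
  set b := Ordinal lt_b.
  have lt_ab : a < b by rewrite /=; lia.
  have k_b : k < b by rewrite /=; lia.
  have [szb rowb] := lab1.2 b k_b.
  eapply runs_weaken => [||s2 I2 _]; last exact: I2.
    apply: runs_assign_seq => /=; rewrite vl1 lab1.1.
    set s2 := set_scalar _ Vmin _.
    have Nb q : cells s2 N (scalars s2 Vi) q = cells s1 N b.+1 q by [].
    apply: (@runs_seq _ _ _ (40 * k) 20 (fun s' =>
              scalars s' Vmin + 1 = distance e (v a) (v b))).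
      eapply runs_weaken; first apply: (@min_loop_runs s2 k k_gt0 szb).
      - by rewrite /= vl1 lab1.1.
      - by [].
      move=> s3 [[t t_k mt] m_le] _; rewrite addn1.
      apply: (@distance_step s1 a b (scalars s3 Vmin) I1 lt_ab).
      - by exists t => //; rewrite mt /= vl1 lab1.1.
      - by move=> r /m_le; rewrite /= vl1 lab1.1.
      - exact: rowb.
    move=> s3 min3 F3.
    have labV i : cells s3 V 0 i = cells s1 V 0 i by rewrite F3.2.
    rewrite addnS; split=> //=; apply: (@known_store s1 _ a b) => //= p q.
    by rewrite min3 !labV !F3.1 //= vl1 -[c.+1 + m]/b.+1 !lab1.1 F3.2.
  by move=> /=; lia.
- by rewrite subSS /=; nia.
move=> s' [diag pairs] _; split=> // x y lt_xy xy; apply: pairs => //.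
by have := ltn_ord y; lia.
Qed.

(** The pairs of round [l] are covered by the first inner loop up to the label [k + 1]
and by the second one beyond; this is the only part of the program whose cost is of
order [k * n ^ 2]. *)
Lemma fill_distances_runs s :
  labeled s -> scalars s Vn = n -> scalars s Vk = k ->
  (forall u : 'I_n, cells s D u.+1 u.+1 = 0) ->
  runs fill_distances s (300 * (k * n ^ 2))
    (fun s' => forall u w : 'I_n, cells s' D u.+1 w.+1 = distance e u w).
Proof.
move=> lab_s vn vk diag0; eapply runs_weaken.
- apply: (@runs_for _ _ _ _ _ (n * (40 * k + 40) + 40 * k + 80) 1 n
            (fun m s' => known s' m m.+1)) => //.
  + by split=> // a b; lia.
  move=> m s1 lt_m I1 F1.
  have lab1 : labeled s1 by apply: labeled_cells lab_s; rewrite F1.2.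
  have vk1 : scalars s1 Vk = k by rewrite F1.1.
  have vn1 : scalars s1 Vn = n by rewrite F1.1.
  have lt_a : m < n by lia.
  set a := Ordinal lt_a.
  eapply runs_weaken => [||s2 I2 _]; last exact: I2.
    apply: (@runs_seq _ _ _ (40 * k + 40) (20 + (n * (40 * k + 40) + 10))).
      by apply: (@clique_pairs_runs _ a).
    move=> s2 I2 F2.
    have lab2 : labeled s2 by apply: labeled_cells lab1; rewrite F2.2.
    have vk2 : scalars s2 Vk = k by rewrite F2.1.
    have vn2 : scalars s2 Vn = n by rewrite F2.1.
    have vl2 : scalars s2 Vl = m.+1 by rewrite F2.1.
    apply: (@runs_seq _ _ _ _ _ (fun s' => cells s' = cells s2 /\
             scalars s' Vw = maxn k.+1 a.+1)).
      eapply runs_weaken => [||s' I' _]; last exact: I'.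
        apply: (@runs_if _ _ _ _ 10) => /=; rewrite vk2 vl2.
          by rewrite eqb0 negbK => le_ak; split=> //=; rewrite vk2; split=> //; lia.
        by move=> /eqP; rewrite eqb0 => le_ak; split=> //=; rewrite vl2; split=> //; lia.
      by [].
    move=> s3 [c3 w3] F3; eapply runs_weaken.
    - apply: (@later_pairs_runs _ a) => //; rewrite ?F3.1 //.
        by apply: labeled_cells lab2; rewrite c3.
      by move: I2; rewrite /known c3.
    - by [].
    move=> s' [diag pairs] _; split=> // x y lt_xy xy; apply: pairs => //=.
    by have := ltn_ord y; lia.
  by lia.
- by move=> /=; nia.
rewrite subn1 => s' [diag pairs] _ u w.
have [g gK vK] := v_bij; rewrite -[u]vK -[w]vK.
case: (ltngtP (g u) (g w)) => [lt_uw|lt_wu|/val_inj ->]; last by rewrite diag distance_refl.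
  by have [|-> _ //] := pairs _ _ lt_uw; left; exact: ltn_ord.
rewrite (distance_sym connected_e sym_e).
by have [|_ -> //] := pairs _ _ lt_wu; left; exact: ltn_ord.
Qed.

End Distances.

(** * Output and total running time *)

Lemma half_sum_runs n (e : rel 'I_n) (v : 'I_n -> 'I_n) s :
  symmetric e -> (forall x y, connect e x y) -> bijective v -> 0 < n ->
  (forall i : 'I_n, cells s V 0 i.+1 = (v i).+1) -> scalars s Vn = n ->
  (forall u w : 'I_n, cells s D u.+1 w.+1 = distance e u w) ->
  runs half_sum s (60 * n ^ 2) (fun s' => scalars s' Vres = wiener e).
Proof.
move=> sym_e connected_e v_bij n_gt0 vertex_v vn dist.
pose dsum i c := \sum_(j <- iota 1 c) cells s D (cells s V 0 i) (cells s V 0 j).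
eapply runs_weaken => [||s' I' _]; last exact: I'.
  apply: runs_assign_seq => /=.
  apply: (@runs_seq _ _ _ (50 * n ^ 2) 5 (fun s' => scalars s' Vsum = (wiener e).*2)).
    eapply runs_weaken.
    - apply: (@runs_for _ _ _ _ _ (40 * n) 1 n
        (fun m s' => scalars s' Vsum = \sum_(i <- iota 1 m) dsum i n)) => //.
      + by rewrite big_nil.
      move=> m s1 lt_m I1 F1.
      have vn1 : scalars s1 Vn = n by rewrite F1.1.
      eapply runs_weaken.
      + apply: (@runs_for _ _ _ _ _ 20 1 n
          (fun p s' => scalars s' Vsum = \sum_(i <- iota 1 m) dsum i n + dsum m.+1 p)) => //.
        * by rewrite /= I1 /dsum big_nil addn0.
        move=> p s2 lt_p I2 F2.
        have vi2 : scalars s2 Vi = m.+1 by rewrite F2.1.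
        split=> //=; rewrite I2 vi2 !F2.2 //= !F1.2 //= /dsum iota_rcons big_rcons /=.
        by lia.
      + by move=> /=; nia.
      move=> s2; rewrite subn1 => -> _.
      by rewrite iota_rcons big_rcons /= addnC.
    - by move=> /=; nia.
    move=> s1; rewrite subn1 => -> _.
    rewrite -(sum_distance connected_e sym_e) sum_iota1 /dsum.
    rewrite [RHS](reindex v) /=; last exact: onW_bij.
    apply: eq_bigr => i _; rewrite sum_iota1 [RHS](reindex v) /=; last exact: onW_bij.
    by apply: eq_bigr => j _; rewrite !vertex_v dist.
  by move=> s1 sum1 _; split=> //=; rewrite sum1 divn2 doubleK.
by move=> /=; nia.
Qed.

(** The shortcut taken for complete graphs, where all distances are 1. *)
Lemma wiener_complete n (e : rel 'I_n) :
  irreflexive e -> symmetric e -> (forall x y : 'I_n, x != y -> e x y) ->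
  n * (n - 1) %/ 2 = wiener e.
Proof.
move=> irr_e sym_e cmp.
have conn x y : connect e x y.
  by have [->|neq] := eqVneq x y; [exact: connect0 | apply/connect1/cmp].
rewrite -[wiener e]doubleK -(sum_distance conn sym_e) divn2; congr half.
transitivity (\sum_(x < n) (n - 1)); first by rewrite sum_nat_const card_ord.
apply: eq_bigr => x _; rewrite (bigD1 x) //= distance_refl add0n.
rewrite (eq_bigr (fun=> 1)) => [|y neq]; last first.
  by apply: distance_adjacent; rewrite 1?eq_sym // cmp // eq_sym.
rewrite sum1_card; have := cardC1 x; rewrite card_ord subn1 => <-.
by apply: eq_card => y; rewrite !inE.
Qed.

(** If the test for completeness fails, the graph is not [K_(k+1)], so it has more than
[k + 1] vertices and exactly two leaves, which starts the elimination. *)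
Lemma algorithm1_runs k n (e : rel 'I_n) (s : state) :
  0 < k -> symmetric e -> irreflexive e -> linear_ktree e k -> holds_input k e s ->
  runs algorithm1 s (2000 * (k * n ^ 2)) (fun s' => scalars s' Vres = wiener e).
Proof.
move=> k_gt0 sym_e irr_e lin inp.
have card_T : #|[set: 'I_n]| = n by rewrite cardsT card_ord.
have tree_lt : ktree e k -> k < n by move/ktree_card; rewrite card_T.
have k_n : k < n by case: lin => [[<- _]|[/tree_lt //]]; rewrite card_ord.
have n_gt0 : 0 < n by lia.
eapply runs_weaken => [||s' I' _]; last exact: I'.
  apply: (@runs_seq _ _ _ (40 * n ^ 2) (2 + 1000 * (k * n ^ 2))).
    exact: (test_complete_runs n_gt0 inp).
  move=> s1; set b := [forall _, _] => Vc1 F1.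
  have {}inp : holds_input k e s1 by apply: holds_input_frame F1.
  have [vn vk _] := inp.
  eapply runs_weaken => [||s' I' _]; last exact: I'.
    apply: (@runs_if _ _ _ _ (1000 * (k * n ^ 2))) => /=; rewrite Vc1.
      rewrite eqb0 negbK => /forallP cmp; split=> //=; last by nia.
      rewrite vn; apply: wiener_complete => // x y neq.
      wlog lt_xy : x y neq / x < y.
        move=> H; case: (ltngtP x y) (neq) => [/H-> //||/val_inj->]; rewrite ?eqxx //.
        by rewrite eq_sym sym_e => /H H' /H'.
      by have /forallP/(_ y)/implyP := cmp x; apply.
    move=> /eqP; rewrite eqb0 => not_cmp.
    have [kt two] : ktree e k /\ #|leaves e k [set: 'I_n]| = 2.
      case: lin => [[_ /cliqueP cmp]|[kt two]]; last first.
        split=> //; rewrite -two; apply: eq_card => x; rewrite !inE; congr (_ == _).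
        by apply: eq_card => y; rewrite !inE.
      case/negP: not_cmp; apply/forallP=> x; apply/forallP=> y; apply/implyP=> lt_xy.
      by apply: cmp; rewrite ?inE // neq_ltn lt_xy.
    have lt_kn : k.+1 < n.
      rewrite ltn_neqAle k_n andbT; apply: contra not_cmp => /eqP n_eq.
      apply/forallP=> x; apply/forallP=> y; apply/implyP=> lt_xy.
      have /cliqueP cmp : clique e [set: 'I_n] by apply: ktree_small kt _; rewrite card_T.
      by apply: cmp; rewrite ?inE // neq_ltn lt_xy.
    have conn x y : connect e x y by apply: ktree_connected kt _ _ _ _; rewrite ?inE.
    eapply runs_weaken => [||s' I' _]; last exact: I'.
      apply: (@runs_seq _ _ _ (80 * n ^ 2)
               (200 * n ^ 2 + (100 * n + (300 * (k * n ^ 2) + 60 * n ^ 2)))).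
        exact: (initialize_runs n_gt0 inp).
      move=> s2 init2 F2.
      have inp2 : holds_input k e s2 by apply: holds_input_frame F2.
      have D2 (u w : 'I_n) : cells s2 D u.+1 w.+1 = 0 by case: init2.
      apply: runs_seq.
        exact: (eliminate_runs sym_e irr_e inp2 lt_kn (elim_init inp2 init2 kt two)).
      move=> s3 [lab3 elim3] F3.
      have inp3 : holds_input k e s3 by apply: holds_input_frame F3.
      apply: runs_seq.
        exact: (label_rest_runs irr_e inp3 elim3 k_n).
      move=> s4 [lab [part small]] F4.
      have [vn4 vk4 _] : holds_input k e s4 by apply: holds_input_frame F4.
      have [lab_inj [v v_bij labK]] := labels_bijective part.
      have clique_lab x : clique e (earlier e lab x).
        have [/(label_earlier part)[] // | le_lab] := ltnP k.+1 (lab x).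
        apply: clique_sub small; apply/subsetP=> y; rewrite !inE => /andP[_ lt_y].
        by rewrite (leq_trans (ltnW lt_y)).
      have lab4 : labeled k e lab v s4.
        split=> i; first by rewrite -labK (label_vertex part) // labK.
        move=> k_i; rewrite -labK.
        by have [|_ -> ->] := label_earlier part (u := v i); rewrite ?labK.
      have fill := fill_distances_runs sym_e irr_e conn lab_inj labK v_bij
                     clique_lab small k_gt0 k_n.
      apply: runs_seq.
        by apply: (fill s4 lab4 vn4 vk4) => u; rewrite F4.2 // F3.2.
      move=> s5 dist5 F5.
      have lab5 : labeled k e lab v s5 by apply: labeled_cells lab4; rewrite F5.2.
      by apply: (half_sum_runs sym_e conn v_bij n_gt0 lab5.1 _ dist5); rewrite F5.1.
    by nia.
  by move=> /=; lia.
by nia.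
Qed.

Theorem proposition2 :
  exists C : nat,
    forall (k n : nat) (e : rel 'I_n) (s : state),
      0 < k ->
      symmetric e -> irreflexive e ->
      linear_ktree e k ->
      holds_input k e s ->
      output algorithm1 s = wiener e
      /\ running_time algorithm1 s <= C * (k * n ^ 2).
Proof.
exists 2000 => k n e s k_gt0 sym_e irr_e lin inp.
exact: algorithm1_runs.
Qed.
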